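(* Let $G=(V,E)$ be a tree DAG with at least one edge, i.e. the skeleton of $G$ is a rooted tree and all edges point away from the root. Let $\Omega=[-1,1]^E$ and let $\varphi:\Omega\to\mathbb{R}$ be a strictly positive real-analytic function such that $\varphi(\omega)\,d\omega$ is a probability measure on $\Omega$. Let $m$ be the length (number of edges) of the longest undirected path in $G$. Then there is a constant $C>0$ such that the volume of $\lambda$-strong-unfaithful distributions satisfies, as $\lambda\to0^+$, $$V_G(\lambda)\;\approx\;C\,\lambda\,(-\ln\lambda)^{m-1}.$$
   Context: $V=\{1,\dots,p\}$ with vertices topologically ordered: $(i,j)\in E$ implies $i<j$. For parameters $a=(a_{ij})_{(i,j)\in E}\in\mathbb{R}^E$, $A_G$ is the strictly upper triangular $p\times p$ matrix with entry $a_{ij}$ if $(i,j)\in E$ and $0$ otherwise, and $K=(A_G-I)(A_G-I)^T$ is the concentration matrix. For $i\ne j$ and $S\subset V\setminus\{i,j\}$ put $R=V\setminus(S\cup\{i,j\})$, $iR=\{i\}\cup R$, $jR=\{j\}\cup R$. Up to sign, the partial correlation is $$\mathrm{corr}(i,j|S)=\frac{\det(K_{iR,jR})}{\sqrt{\det(K_{iR,iR})\det(K_{jR,jR})}},$$ a function of $a$ (the denominator is strictly positive). d-separation: an undirected path $P$ from $i$ to $j$ d-connects $i$ and $j$ given $S$ if every non-collider on $P$ is not in $S$ and every collider on $P$ is in $S$ or is an ancestor of a node in $S$ (a collider at $k$ is a configuration $\cdot\to k\leftarrow\cdot$ on the path). The nodes $i,j$ are d-separated given $S$ if there is no d-connecting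 path. $V_G(\lambda)=\int_T\varphi(\omega)\,d\omega$, where $T$ is the union of all sets $\{\omega\in\Omega:|\mathrm{corr}(i,j|S)|\le\lambda\}$ over triples $(i,j,S)$ such that $i,j$ are not d-separated given $S$. The notation $V(\lambda)\approx h(\lambda)$ means $V(\lambda)=h(\lambda)+o(h(\lambda))$ as $\lambda\to0^+$. *)

(* Defs.v *)
From HB Require Import structures.
From mathcomp Require Import all_boot all_order all_algebra.
From mathcomp Require Import all_classical all_reals all_analysis.

Set Implicit Arguments.
Unset Strict Implicit.
Unset Printing Implicit Defensive.

Import Order.TTheory GRing.Theory Num.Theory.
Import numFieldNormedType.Exports.

Local Open Scope classical_set_scope.
Local Open Scope ring_scope.

Section LebesgueTuple.
Context {R : realType}.
Local Notation RB := (measurableTypeR R).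
Local Open Scope ereal_scope.

Definition cons_pair n (z : RB * n.-tuple RB) : n.+1.-tuple RB :=
  [tuple of z.1 :: z.2].

(* n-dimensional Lebesgue measure on the product sigma-algebra of R^n *)
Fixpoint lebesgue_tuple n : set (n.-tuple RB) -> \bar R :=
  match n return set (n.-tuple RB) -> \bar R with
  | 0 => \d_[tuple]
  | n'.+1 =>
      pushforward (lebesgue_measure \x @lebesgue_tuple n') (@cons_pair n')
  end.

Lemma measurable_cons_pair n : measurable_fun [set: _] (@cons_pair n).
Proof. exact: measurable_cons. Qed.

Lemma pushforward_cons_sigma_finite n
    (mu : {measure set (RB * n.-tuple RB)%type -> \bar R}) :
  sigma_finite setT mu -> sigma_finite setT (pushforward mu (@cons_pair n)).
Proof.
move=> [F TF mF].
pose g (t : n.+1.-tuple RB) := (thead t, [tuple of behead t]).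
have gK (z : RB * n.-tuple RB) : g (cons_pair z) = z.
  by case: z => x t; rewrite /g /cons_pair/= theadE; congr pair; exact: val_inj.
have mg : measurable_fun setT g.
  by apply/measurable_fun_pairP; split;
    [exact: measurable_tnth | exact: measurable_behead].
exists (fun k => g @^-1` F k).
  by rewrite -preimage_bigcup -TF preimage_setT.
move=> k; have [mFk Fk] := mF k; split.
  by rewrite -[X in measurable X]setTI; exact: mg.
rewrite /pushforward (_ : _ @^-1` _ = F k)//.
by apply/seteqP; split => z /=; rewrite gK.
Qed.

(* Reproved because the canonical sigma-finite structure on [m1 \x m2] is
   shadowed by the one for products of probability measures. *)
Lemma product_sigma_finite d1 d2 (T1 : measurableType d1)
    (T2 : measurableType d2) (m1 : {sigma_finite_measure set T1 -> \bar R})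
    (m2 : {sigma_finite_measure set T2 -> \bar R}) :
  sigma_finite setT (m1 \x m2).
Proof.
have /sigma_finiteP[F [TF ndF Foo]] := sigma_finiteT m1.
have /sigma_finiteP[G [TG ndG Goo]] := sigma_finiteT m2.
exists (fun n => F n `*` G n).
  rewrite -setXTT TF TG predeqE => -[x y]; split.
    move=> [/= [n _ Fnx] [k _ Gky]]; exists (maxn n k) => //; split.
    - by move: x Fnx; exact/subsetPset/ndF/leq_maxl.
    - by move: y Gky; exact/subsetPset/ndG/leq_maxr.
  by move=> [n _ []/= ? ?]; split; exists n.
move=> k; have [? ?] := Foo k; have [? ?] := Goo k.
split; first exact: measurableX.
by rewrite product_measure1E// lte_mul_pinfty// ge0_fin_numE.
Qed.

Definition sigma_finite_measure_of d (T : measurableType d)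
  (mu : {measure set T -> \bar R}) (h : sigma_finite setT mu) :
  set T -> \bar R := mu.

HB.instance Definition _ d (T : measurableType d)
  (mu : {measure set T -> \bar R}) (h : sigma_finite setT mu) :=
  Measure.on (sigma_finite_measure_of h).

HB.instance Definition _ d (T : measurableType d)
  (mu : {measure set T -> \bar R}) (h : sigma_finite setT mu) :=
  Measure_isSigmaFinite.Build _ _ _ (sigma_finite_measure_of h) h.

Lemma lebesgue_tuple_sfm n :
  {mu : {sigma_finite_measure set (n.-tuple RB) -> \bar R}
      | (mu : set _ -> \bar R) = @lebesgue_tuple n}.
Proof.
elim: n => [|n [mu muE]].
  by exists (\d_[tuple] : {sigma_finite_measure set (0.-tuple RB) -> \bar R}).
rewrite /= -muE.
have h := pushforward_cons_sigma_finite
  (@product_sigma_finite _ _ RB _ lebesgue_measure mu).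
pose pf : {measure set (n.+1.-tuple RB) -> \bar R} :=
  @pushforward _ _ _ _ _ (lebesgue_measure \x mu) (@cons_pair n).
pose nu := pf (@measurable_cons_pair n).
by exists (@sigma_finite_measure_of _ _ nu h
  : {sigma_finite_measure set (n.+1.-tuple RB) -> \bar R}).
Qed.

Let lebesgue_tuple0 n : @lebesgue_tuple n set0 = 0.
Proof. by case: (lebesgue_tuple_sfm n) => mu <-; exact: measure0. Qed.

Let lebesgue_tuple_ge0 n A : 0 <= @lebesgue_tuple n A.
Proof. by case: (lebesgue_tuple_sfm n) => mu <-; exact: measure_ge0. Qed.

Let lebesgue_tuple_sigma_additive n : semi_sigma_additive (@lebesgue_tuple n).
Proof.
by case: (lebesgue_tuple_sfm n) => mu <-; exact: measure_semi_sigma_additive.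
Qed.

Let lebesgue_tuple_sigma_finite n : sigma_finite setT (@lebesgue_tuple n).
Proof. by case: (lebesgue_tuple_sfm n) => mu <-; exact: sigma_finiteT. Qed.

HB.instance Definition _ n := isMeasure.Build _ _ _ (@lebesgue_tuple n)
  (@lebesgue_tuple0 n) (@lebesgue_tuple_ge0 n)
  (@lebesgue_tuple_sigma_additive n).

HB.instance Definition _ n := Measure_isSigmaFinite.Build _ _ _
  (@lebesgue_tuple n) (@lebesgue_tuple_sigma_finite n).

Lemma lebesgue_tuple_box n (A : 'I_n -> set RB) :
  (forall k, measurable (A k)) ->
  lebesgue_tuple [set t : n.-tuple RB | forall k, A k (tnth t k)] =
    \prod_(k < n) lebesgue_measure (A k).
Proof.
elim: n A => [|n IH] A mA.
  rewrite big_ord0 /= diracE mem_set//.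
  by case.
rewrite big_ord_recl -IH//= /pushforward.
set B := [set t : n.-tuple RB | _].
have -> : @cons_pair n @^-1` [set t | forall k, A k (tnth t k)] =
    A ord0 `*` B.
  apply/seteqP; split => [[x t]|[x t]] /=.
    move=> H; split=> [|k]; first by have := H ord0; rewrite tnth0.
    by have := H (lift ord0 k); rewrite /cons_pair/= tnthS.
  move=> [H0 H] k; case: (unliftP ord0 k) => [j|] ->; last by rewrite tnth0.
  by rewrite tnthS; exact: H.
rewrite product_measure1E//.
rewrite (_ : B = \big[setI/setT]_(k < n)
   ((fun t : n.-tuple RB => tnth t k) @^-1` A (lift ord0 k))).
  apply: bigsetI_measurable => k _.
  by rewrite -[X in measurable X]setTI; exact: measurable_tnth.
apply/seteqP; split => t.
  by move=> H; rewrite -bigcap_seq => k _; exact: H.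
by rewrite -bigcap_seq => H k; apply: H; rewrite /= mem_index_enum.
Qed.

End LebesgueTuple.

Section RealAnalytic.
Context {R : realType} {n : nat}.
Implicit Types (f : n.-tuple (measurableTypeR R) -> R).

Definition power_term (c : {ffun 'I_n -> nat} -> R)
    (w x : n.-tuple (measurableTypeR R)) (alpha : {ffun 'I_n -> nat}) : R :=
  c alpha * \prod_(k < n) ((tnth x k : R) - tnth w k) ^+ alpha k.

(* On a closed cube A this is equivalent to f|A having a real-analytic
   extension to an open neighbourhood of A. By absolute summability the sum
   of the series does not depend on the order of summation. *)
Definition real_analytic_on (A : set (n.-tuple (measurableTypeR R))) f :=
  forall w, A w -> exists (c : {ffun 'I_n -> nat} -> R) (r : R), 0 < r /\
    forall x, A x -> (forall k, `|(tnth x k : R) - tnth w k| < r) ->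
      summable [set: {ffun 'I_n -> nat}] (EFin \o power_term c w x) /\
      (fun N => \sum_(alpha : {ffun 'I_n -> 'I_N})
         power_term c w x [ffun k => val (alpha k)]) @ \oo --> f x.

End RealAnalytic.

Section Graph.
Context {p : nat} (e : rel 'I_p).
Implicit Types (i j : 'I_p) (s : seq 'I_p) (S : {set 'I_p}).

Definition topologically_ordered := forall i j, e i j -> (i < j)%N.

Definition skeleton : rel 'I_p := [rel i j | e i j || e j i].

(* [i :: s] is a path of length [size s] (without repeated vertices) from [i]
   to [last i s] in the skeleton *)
Definition undirected_path i s := path skeleton i s && uniq (i :: s).

(* simple cycles of size 2 are edges traversed back and forth *)
Definition is_tree (g : rel 'I_p) :=
  (forall i j, connect g i j) /\ (forall c, ucycle g c -> (size c <= 2)%N).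

(* the edge [i -> j] points away from [r] when the path from [r] to [j] in the
   skeleton passes through [i] *)
Definition points_away_from r i j :=
  forall s, undirected_path r s -> last r s = j -> i \in r :: s.

Definition tree_dag :=
  is_tree skeleton /\ exists r, forall i j, e i j -> points_away_from r i j.

(* position [k] of the path [i :: s]; position 0 is [i] *)
Definition is_collider i s (k : nat) : bool :=
  let v := nth i (i :: s) in
  [&& (0 < k)%N, (k < size s)%N, e (v k.-1) (v k) & e (v k.+1) (v k)].

Definition d_connecting i j S s :=
  [/\ undirected_path i s, last i s = j &
      forall k, (k <= size s)%N ->
        let v := nth i (i :: s) k in
        if is_collider i s k
        then v \in S \/ exists2 w, w \in S & connect e v w
        else v \notin S].

Definition d_separated i j S := ~ exists s, d_connecting i j S s.

Definition longest_path_length (m : nat) :=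
  (exists i s, undirected_path i s /\ size s = m) /\
  (forall i s, undirected_path i s -> (size s <= m)%N).

End Graph.

Notation edge e := {ij : _ * _ | e ij.1 ij.2}.

Section PartialCorrelation.
Context {R : realType} {p : nat} (e : rel 'I_p).

(* R^E, the edges being enumerated by [enum_rank] *)
Definition params := #|{: edge e}|.-tuple (measurableTypeR R).
Implicit Types (a : params) (i j : 'I_p) (S : {set 'I_p}).

Definition coef_matrix a : 'M[R]_p :=
  \matrix_(i, j) if (insub (i, j) : option (edge e)) is Some ij
                 then tnth a (enum_rank ij) else 0.

Definition concentration a : 'M[R]_p :=
  (coef_matrix a - 1%:M) *m (coef_matrix a - 1%:M)^T.

(* enumerates [{i} :|: A] as [i] followed by the elements of [A] in increasing
   order; reordering rows or columns only changes minors up to sign *)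
Definition adjoin_index i (A : {set 'I_p}) (k : 'I_(1 + #|A|)) : 'I_p :=
  match fintype.split k with inl _ => i | inr l => enum_val l end.

(* the partial correlation up to sign; only its absolute value is used below *)
Definition corr a i j S : R :=
  let A := ~: (S :|: [set i; j]) in
  let minor u v :=
    \det (mxsub (@adjoin_index u A) (@adjoin_index v A) (concentration a)) in
  minor i j / Num.sqrt (minor i i * minor j j).

Definition cube : set params :=
  [set a | forall k, (tnth a k : R) \in `[-1, 1]].

Definition strong_unfaithful (lambda : R) : set params :=
  [set a | cube a /\ exists i j S,
    [/\ i != j, i \notin S, j \notin S, ~ d_separated e i j S &
        `|corr a i j S| <= lambda]].

Definition unfaithful_volume (phi : params -> R) (lambda : R) : R :=
  (\int[@lebesgue_tuple R _]_(a in strong_unfaithful lambda) phi a)%R.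

End PartialCorrelation.

Arguments params R {p} e.
Arguments cube R {p} e.

(* Main.v *)
(** On a tree all colliders are absent, so a path d-connects its ends given [S]
iff it avoids [S].  Let [B] be the complement of [S].  Up to a positive factor
the partial correlation is the [(i, j)] entry of the inverse of [K] restricted
to [B].  Since off the diagonal [K] is supported on the tree, cutting the tree
at the first edge [v0 v1] of the path gives
[(K_B^-1) v0 j = - K v0 v1 * (K_C^-1) v0 v0 * (K_B^-1) v1 j], where [C] is the
side of [v0].  Hence [|corr(i, j | S)|] is the product of the [|a_k|] over the
edges [k] of the path times a positive continuous function of [a].

It remains to measure a finite union of sets [{prod_(k in P) |a_k| * u(a) <= l}].
For constant [u] the volume is explicit and of order [l * (- ln l)^(|P| - 1)].
After division by [l * (- ln l)^(m - 1)] the contributions of [|P| < m], of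
pairs of distinct [P] of size [m], and of points where some coordinate in [P]
is away from 0 all vanish in the limit.  For [|P| = m], [u] and the density are
frozen on the cells of a fine grid; upper and lower limits then differ by
arbitrarily little, so the limit exists, and it is positive. *)
Require Import Defs.
From mathcomp Require Import all_boot all_order all_algebra perm ring lra.
From mathcomp Require Import all_classical all_reals all_analysis measurable_realfun.

Set Implicit Arguments.
Unset Strict Implicit.

Import Order.TTheory GRing.Theory Num.Theory.
Import numFieldNormedType.Exports.

Local Open Scope classical_set_scope.
Local Open Scope ring_scope.

(** * Tree DAGs *)

Section TreeDag.
Context {p : nat} (e : rel 'I_p).
Implicit Types (i j u v : 'I_p) (s : seq 'I_p).

(** Many triples share an edge set: every conditioning set that avoids a given path yields the same
    product of coordinates with another factor [u]. Their sublevel sets overlap to leading order, so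
    their volumes cannot be added. They are grouped by edge set, and within a group the union is
    governed by the least [u]. Only groups with different edge sets are asymptotically disjoint. For
    [t < 1] the set [|x_1 ... x_m| <= t] in [[-1, 1]^m] has volume [2^m t] times the sum over
    [j < m] of [(- ln t)^j / j!]. The leading term comes from points near the face where all
    coordinates in [P] vanish. Hence [u] and the density are evaluated with those coordinates at 0,
    while in the boxes the same coordinates keep the whole range [[-1, 1]], so that the volume
    formula remains exact. Each edge set of size [m] thus contributes [2^m / (m-1)!] times the
    integral of the density over the least [u] on its face. That integral occurs only through
    Riemann sums: the limit exists by a Cauchy argument and is positive by comparison with constant
    [u] and density. *)

Lemma skeleton_sym : symmetric (skeleton e).
Proof. by move=> u v; rewrite /skeleton /= orbC. Qed.

(** The path from the root to [k] passes through both parents. If [i] comes before [j] on it, the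
    initial piece up to [i] followed by [k] is a path from the root to [k] that misses [j], although
    [j -> k] points away from the root. *)
Lemma parent_unique i j k :
  topologically_ordered e -> tree_dag e -> e i k -> e j k -> i = j.
Proof.
move=> eo [[conn _] [r away]] eik ejk; apply/eqP; apply: contraT => nij.
have /connectP[s0 s0p s0l] := conn r k.
case/shortenP: s0p s0l => s sp su _ lsk {s0}.
have inP i' : e i' k -> i' \in r :: s.
  by move=> h; apply: (away _ _ h s) => //; rewrite /undirected_path sp.
wlog ij : i j eik ejk nij / (index i (r :: s) < index j (r :: s))%N => [wl|].
  case: (ltngtP (index i (r :: s)) (index j (r :: s))) => H.
  - exact: (wl i j).
  - by apply: (wl j i) => //; rewrite eq_sym.
  - move/eqP: nij; case.
    by rewrite -(nth_index i (inP _ eik)) H nth_index // inP.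
have ri := inP _ eik; have rj := inP _ ejk.
have ltik := eo _ _ eik; have ltjk := eo _ _ ejk.
case/splitPl: ri sp su lsk ij rj {inP} => s1 s2 ls1.
rewrite cat_path => /andP[p1 p2] su lsk ij rj.
have us1 : uniq (r :: s1) by move: su; rewrite -cat_cons cat_uniq => /and3P[].
have kns1 : k \notin r :: s1.
  have : k \in s2.
    case: s2 lsk {p2 su ij rj} => [|x s2].
      by rewrite cats0 ls1 => ki; rewrite ki ltnn in ltik.
    by rewrite last_cat /= => ->; exact: mem_last.
  by move: su; rewrite -cat_cons cat_uniq => /and3P[_ /hasPn h _] /h.
have P : undirected_path e r (rcons s1 k).
  rewrite /undirected_path rcons_path p1 ls1 /= /skeleton /= eik /=.
  by rewrite -[_ && uniq _]/(uniq (r :: rcons s1 k)) -rcons_cons rcons_uniq kns1.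
have := away _ _ ejk _ P (last_rcons _ _ _).
rewrite -rcons_cons mem_rcons inE => /orP[/eqP jk|js1].
  by rewrite jk ltnn in ltjk.
move: ij; rewrite -cat_cons !index_cat js1.
have -> : i \in r :: s1 by rewrite -ls1 mem_last.
rewrite -ls1 index_last // => h.
by move: js1; rewrite -index_mem /= ltnNge h.
Qed.

Lemma no_collider i s k :
  topologically_ordered e -> tree_dag e -> undirected_path e i s ->
  ~~ is_collider e i s k.
Proof.
move=> eo et /andP[_ us]; apply/negP => /and4P[k0 ks e1 e2].
have /eqP := parent_unique eo et e1 e2.
rewrite nth_uniq //=; last by rewrite ltnS (leq_trans _ (ltnW ks)) // leq_pred.
by case: k k0 {ks e1 e2} => // k _; rewrite /= => /eqP; elim: k => // k IH [].
Qed.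

Definition skeleton_minus u v : rel 'I_p :=
  [rel x y | [&& skeleton e x y, (x, y) != (u, v) & (x, y) != (v, u)]].

(** A simple path from [u] to [v] without the edge itself has at least two steps, so the edge closes
    it to a cycle of size at least 3. *)
Lemma bridge u v : is_tree (skeleton e) -> u != v -> skeleton e u v ->
  ~~ connect (skeleton_minus u v) u v.
Proof.
move=> [_ nocyc] uv euv; apply/negP => /connectP[s0 s0p s0l].
case/shortenP: s0p s0l => s sp su _ lsv {s0}.
have cyc : ucycle (skeleton e) (u :: s).
  rewrite /ucycle su andbT /= rcons_path -lsv skeleton_sym euv andbT.
  by apply: sub_path sp => x y /and3P[].
have := nocyc _ cyc.
case: s sp su lsv {cyc} => [|x [|y s]] //=.
- by move=> _ _ vu; rewrite vu eqxx in uv.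
- by move=> /andP[/and3P[_ /eqP h] _] _ _ vx; rewrite vx in h.
Qed.

End TreeDag.

(** * Inverses of restricted positive definite matrices *)

Section PositiveDefinite.
Context {R : realType} {p : nat}.
Implicit Types (M : 'M[R]_p) (B C : {set 'I_p}).

Definition positive_definite M :=
  forall x : 'rV[R]_p, x != 0 -> 0 < (x *m M *m x^T) 0 0.

Lemma row_norm2_gt0 (x : 'rV[R]_p) : x != 0 -> 0 < (x *m x^T) 0 0.
Proof.
move=> x0; rewrite mxE lt_neqAle sumr_ge0 ?andbT; last first.
  by move=> k _; rewrite mxE -expr2 sqr_ge0.
apply: contra x0; rewrite eq_sym psumr_eq0 => [/allP h|k _]; last first.
  by rewrite mxE -expr2 sqr_ge0.
apply/eqP/rowP => k; have := h k; rewrite mem_index_enum => /(_ isT).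
by rewrite !mxE -expr2 sqrf_eq0 => /eqP.
Qed.

Lemma row_norm2_ge0 (x : 'rV[R]_p) : 0 <= (x *m x^T) 0 0.
Proof.
have [->|/row_norm2_gt0/ltW//] := eqVneq x 0.
by rewrite mul0mx mxE.
Qed.

Lemma positive_definite_unitmx M : positive_definite M -> M \in unitmx.
Proof.
move=> pM; rewrite unitmxE unitfE; apply/negP => /det0P[v v0 vM].
by have := pM v v0; rewrite vM mul0mx mxE ltxx.
Qed.

(** For [y] the [i]-th row of the inverse, [y *m M] is the [i]-th unit vector, so the quadratic form
    at [y] is the diagonal entry in question. *)
Lemma positive_definite_inv_gt0 M i : positive_definite M -> 0 < invmx M i i.
Proof.
move=> pM; have uM := positive_definite_unitmx pM.
pose y : 'rV[R]_p := row i (invmx M).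
have yM : y *m M = row i 1%:M by rewrite -row_mul mulVmx.
have y0 : y != 0.
  apply/eqP => y0; move: yM; rewrite y0 mul0mx => /rowP/(_ i).
  by rewrite !mxE eqxx => /eqP; rewrite eq_sym oner_eq0.
have := pM y y0; rewrite yM mxE (bigD1 i) //= !mxE eqxx mul1r big1 ?addr0 //.
by move=> k ki; rewrite !mxE eq_sym (negbTE ki) mul0r.
Qed.

(** The block of [M] on [B], completed by the identity, so that all blocks have size [p] and the
    inverse contains the inverse of the block. *)
Definition restrict_mx B M : 'M[R]_p :=
  \matrix_(u, v) if (u \in B) && (v \in B) then M u v else (u == v)%:R.

(** With [D] the coordinate projection onto [B], the quadratic form is that of [M] at [x *m D] plus
    the squared norm of the remaining coordinates, and one of the two does not vanish. *)
Lemma positive_definite_restrict B M :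
  positive_definite M -> positive_definite (restrict_mx B M).
Proof.
move=> pM x x0.
pose D : 'M[R]_p := diag_mx (\row_k (k \in B)%:R).
have DT : D^T = D by rewrite tr_diag_mx.
have -> : restrict_mx B M = D *m M *m D + (1%:M - D) *m (1%:M - D)^T.
  have -> : (1%:M - D) *m (1%:M - D)^T = 1%:M - D.
    apply/matrixP => u v; rewrite linearB /= DT trmx1 mulmxBr mulmx1.
    rewrite mulmxBl mul1mx mul_diag_mx !mxE.
    by case: eqVneq => [->|]; case: (_ \in B);
      rewrite ?mulr1n ?mulr0n ?mulr0 ?mul0r ?mul1r ?subrr ?subr0.
  apply/matrixP => u v; rewrite mul_mx_diag mul_diag_mx !mxE.
  case: (boolP (u \in B)) => uB; case: (boolP (v \in B)) => vB /=;
    rewrite ?mul1r ?mul0r ?mulr1 ?mulr0 ?add0r ?mul0rn ?subr0 //.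
  - by rewrite mulrb subrr addr0.
  - case: eqVneq => [uv|]; last by rewrite subrr.
    by rewrite uv (negbTE vB) in uB.
rewrite mulmxDr mulmxDl mxE.
have -> : x *m (D *m M *m D) *m x^T = (x *m D) *m M *m (x *m D)^T.
  by rewrite trmx_mul DT !mulmxA.
have -> : x *m ((1%:M - D) *m (1%:M - D)^T) *m x^T =
    (x *m (1%:M - D)) *m (x *m (1%:M - D))^T.
  by rewrite trmx_mul !mulmxA.
have [xD0|xD0] := eqVneq (x *m D) 0.
  rewrite xD0 mul0mx mul0mx mxE add0r; apply: row_norm2_gt0.
  by rewrite mulmxBr mulmx1 xD0 subr0.
by rewrite ltr_wpDr ?pM // row_norm2_ge0.
Qed.

(* The column [invmx (restrict_mx B M) _ j], cut off to [C], solves the linear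
   system of [restrict_mx C M] whose right-hand side only sees the single link
   between [C] and the rest of [B]. *)
Lemma restrict_inv_step B C M v0 v1 j : C \subset B ->
  restrict_mx B M \in unitmx -> restrict_mx C M \in unitmx ->
  v0 \in C -> v1 \in B :\: C -> j \in B :\: C ->
  (forall u w, u \in C -> w \in B :\: C -> M u w != 0 -> u = v0 /\ w = v1) ->
  invmx (restrict_mx B M) v0 j =
    - M v0 v1 * invmx (restrict_mx C M) v0 v0 * invmx (restrict_mx B M) v1 j.
Proof.
move=> /fintype.subsetP CB uB uC v0C v1BC jBC link.
set G := invmx (restrict_mx B M).
have GE u : \sum_w restrict_mx B M u w * G w j = (u == j)%:R.
  by have := mulmxV uB => /matrixP/(_ u j); rewrite !mxE.
pose z : 'cV[R]_p := \col_u if u \in C then G u j else 0.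
have Mz : restrict_mx C M *m z = (- M v0 v1 * G v1 j) *: delta_mx v0 0.
  apply/colP => u; rewrite !mxE /= andbT.
  case: (boolP (u \in C)) => uC'; last first.
    rewrite big1 => [|w _].
      by case: eqVneq uC' => [->|]; rewrite ?v0C // mulr0.
    rewrite !mxE (negbTE uC') /=; case: eqVneq => [<-|]; last by rewrite mul0r.
    by rewrite (negbTE uC') mulr0.
  have uj : u != j by apply: contraTneq uC' => ->; move: jBC; rewrite inE => /andP[].
  have := GE u; rewrite (negbTE uj) (bigID (mem C)) /= => /eqP.
  rewrite addr_eq0 => /eqP h.
  rewrite (bigID (mem C)) /= [X in _ + X]big1 ?addr0; last first.
    by move=> w /negbTE wC; rewrite !mxE wC mulr0.
  under eq_bigr => w wC do rewrite !mxE wC uC'.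
  move: h; under eq_bigr => w wC do rewrite !mxE (CB _ wC) (CB _ uC').
  move=> ->.
  rewrite (bigD1 v1) /=; last by move: v1BC; rewrite inE => /andP[].
  rewrite [X in _ + X]big1 ?addr0; last first.
    move=> w /andP[wC wv1]; rewrite !mxE (CB _ uC') /=.
    case: (boolP (w \in B)) => wB; last first.
      by case: eqVneq wC => [<-|]; rewrite ?uC' // mul0r.
    case: (eqVneq (M u w) 0) => [->|Muw]; first by rewrite mul0r.
    have wBC : w \in B :\: C by rewrite inE wC wB.
    have [_ wv] := link u w uC' wBC Muw.
    by rewrite wv eqxx in wv1.
  rewrite mxE (CB _ uC') /=.
  have -> : v1 \in B by move: v1BC; rewrite inE => /andP[].
  have [->|uv0] := eqVneq u v0; first by rewrite mulr1 mulNr.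
  rewrite mulr0; case: (eqVneq (M u v1) 0) => [->|Muv]; first by rewrite mul0r oppr0.
  by have [uv _] := link u v1 uC' v1BC Muv; rewrite uv eqxx in uv0.
have : z = invmx (restrict_mx C M) *m ((- M v0 v1 * G v1 j) *: delta_mx v0 0).
  by rewrite -Mz mulKmx.
move/colP => /(_ v0); rewrite -scalemxAr -colE !mxE v0C => ->.
by rewrite mulrAC.
Qed.

(* The minors of the partial correlation are cofactors of the block of [M] on
   [[:: i, j & A]], whose inverse is the corresponding block of the inverse of
   [restrict_mx B M]. *)
Lemma minors_restrict_inv B M i j : i \in B -> j \in B -> i != j ->
  restrict_mx B M \in unitmx ->
  let A := B :\: [set i; j] in
  let minor u v := \det (mxsub (@adjoin_index p u A) (@adjoin_index p v A) M) in
  let G := invmx (restrict_mx B M) in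
  exists d : R, [/\ d != 0, `|minor i j| = `|d * G i j|, minor i i = d * G j j &
    minor j j = d * G i i].
Proof.
move=> iB jB ij uB A minor G.
have iA : i \notin A by rewrite !inE eqxx.
have jA : j \notin A by rewrite !inE eqxx orbT.
(* Enumerates [B] as [i], [j], then [A]: deleting position 0 or 1 leaves exactly the enumerations by
   [adjoin_index], so the minors become cofactors. *)
pose b (k : 'I_(1 + (1 + #|A|))) : 'I_p :=
  match fintype.split k with inl _ => i | inr l => @adjoin_index p j A l end.
have b0 : b ord0 = i by rewrite /b; case: splitP => // k /=.
have bS (k : 'I_(1 + #|A|)) : b (lift ord0 k) = @adjoin_index p j A k.
  rewrite /b; case: splitP => [k' /=|k' /= kk'].
    by case: k' => -[].
  by congr adjoin_index; apply: val_inj; case: kk'.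
have aj0 u : @adjoin_index p u A ord0 = u.
  by rewrite /adjoin_index; case: splitP.
have ajS u (l : 'I_#|A|) : @adjoin_index p u A (lift ord0 l) = enum_val l.
  rewrite /adjoin_index; case: splitP => [k' /=|k' /= kk'].
    by case: k' => -[].
  by congr enum_val; apply: val_inj; case: kk'.
have sumB (F : 'I_p -> R) : \sum_k F (b k) = \sum_(w in B) F w.
  rewrite big_ord_recl b0; under eq_bigr => k _ do rewrite bS.
  rewrite big_ord_recl aj0; under eq_bigr => k _ do rewrite ajS.
  rewrite (bigD1 i) //=; congr (_ + _).
  rewrite (bigD1 j) /=; last by rewrite jB eq_sym.
  congr (_ + _); rewrite -big_enum_val /=; apply: eq_bigl => w.
  by rewrite !inE negb_or; case: (w \in B); rewrite ?andbT ?andbF.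
have bB k : b k \in B.
  case: (unliftP ord0 k) => [k'|] ->; last by rewrite b0.
  rewrite bS; case: (unliftP ord0 k') => [l|] ->; last by rewrite aj0.
  by rewrite ajS; have := enum_valP l; rewrite inE => /andP[].
have bI : injective b.
  have eA (l : 'I_#|A|) : enum_val l \in A by exact: enum_valP.
  move=> k l; case: (unliftP ord0 k) => [k' ->|->];
    case: (unliftP ord0 l) => [l' ->|->] //.
  - rewrite !bS; case: (unliftP ord0 k') => [k'' ->|->];
      case: (unliftP ord0 l') => [l'' ->|->] //; rewrite ?aj0 ?ajS.
    + by move=> /enum_val_inj ->.
    + by move=> h; move: (eA k''); rewrite h (negbTE jA).
    + by move=> h; move: (eA l''); rewrite -h (negbTE jA).
  - rewrite bS b0; case: (unliftP ord0 k') => [k'' ->|->]; rewrite ?aj0 ?ajS.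
    + by move=> h; move: (eA k''); rewrite h (negbTE iA).
    + by move=> h; rewrite h eqxx in ij.
  - rewrite bS b0; case: (unliftP ord0 l') => [k'' ->|->]; rewrite ?aj0 ?ajS.
    + by move=> h; move: (eA k''); rewrite -h (negbTE iA).
    + by move=> h; rewrite h eqxx in ij.
pose N := mxsub b b M; pose H := mxsub b b G.
(* Rows of [restrict_mx B M] with index in [B] vanish outside [B], so the product restricts to the
   blocks. *)
have NH : N *m H = 1%:M.
  apply/matrixP => k l; rewrite !mxE.
  under eq_bigr => x _ do rewrite !mxE.
  rewrite (sumB (fun w => M (b k) w * G w (b l))).
  have := mulmxV uB => /matrixP/(_ (b k) (b l)); rewrite !mxE.
  rewrite (bigID (mem B)) /= [X in _ + X]big1 ?addr0; last first.
    move=> w wB; rewrite !mxE (negbTE wB) andbF.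
    by case: eqVneq wB => [<-|_ _]; [rewrite bB|rewrite mul0r].
  rewrite (inj_eq bI) => <-; apply: eq_bigr => w wB.
  by rewrite !mxE wB bB.
have uN : N \in unitmx by have [] := mulmx1_unit NH.
have HE : H = invmx N by rewrite -[RHS]mulmx1 -NH mulKmx.
have dN : \det N != 0 by rewrite -unitfE -unitmxE.
have cof k l : cofactor N l k = \det N * G (b k) (b l).
  have := HE => /matrixP/(_ k l); rewrite /invmx uN !mxE => ->.
  by rewrite mulrA divff // mul1r.
pose o1 : 'I_(1 + (1 + #|A|)) := lift ord0 ord0.
have b1 : b o1 = j by rewrite bS aj0.
have adj_i k : b (lift o1 k) = @adjoin_index p i A k.
  case: (unliftP ord0 k) => [l ->|->].
    rewrite ajS -(ajS j) -bS; congr b; exact: val_inj.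
  by rewrite aj0 -b0; congr b; exact: val_inj.
have cofE (o o' : 'I_(1 + (1 + #|A|))) u v :
    (forall k, b (lift o k) = @adjoin_index p u A k) ->
    (forall k, b (lift o' k) = @adjoin_index p v A k) ->
    cofactor N o o' = (-1) ^+ (o + o') * minor u v.
  move=> hu hv; rewrite /cofactor; congr (_ * \det _).
  by apply/matrixP => k l; rewrite !mxE hu hv.
exists (\det N); split => //.
- have := cof ord0 o1; rewrite (cofE _ _ i j adj_i bS) b0 b1 => <-.
  by rewrite normrM normrX normrN1 expr1n mul1r.
- have := cof o1 o1; rewrite (cofE _ _ i i adj_i adj_i) b1 => <-.
  by rewrite /= expr2 mulrNN mulr1 mul1r.
- have := cof ord0 ord0; rewrite (cofE _ _ j j bS bS) b0 => <-.
  by rewrite /= expr0 mul1r.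
Qed.

End PositiveDefinite.

(** * Factorization of partial correlations along paths *)

Section ContinuityOnTuples.
Context {R : realType}.

Lemma continuous_bigsum (T : topologicalType) (I : Type) (r : seq I)
    (P : pred I) (F : I -> T -> R) :
  (forall i, continuous (F i)) ->
  continuous (fun x => \sum_(i <- r | P i) F i x).
Proof.
move=> cF; elim: r => [|i r IH].
  have -> : (fun x => \sum_(i <- [::] | P i) F i x) = (fun=> 0).
    by apply/funext => x; rewrite big_nil.
  by move=> x; exact: cvg_cst.
have [Pi|nPi] := boolP (P i).
  have -> : (fun x => \sum_(j <- i :: r | P j) F j x) =
      (fun x => F i x + \sum_(j <- r | P j) F j x).
    by apply/funext => x; rewrite big_cons Pi.
  by move=> x; apply: cvgD; [exact: cF|exact: IH].
suff -> : (fun x => \sum_(j <- i :: r | P j) F j x) =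
    (fun x => \sum_(j <- r | P j) F j x) by [].
by apply/funext => x; rewrite big_cons (negbTE nPi).
Qed.

Lemma continuous_bigprod (T : topologicalType) (I : Type) (r : seq I)
    (P : pred I) (F : I -> T -> R) :
  (forall i, continuous (F i)) ->
  continuous (fun x => \prod_(i <- r | P i) F i x).
Proof.
move=> cF; elim: r => [|i r IH].
  have -> : (fun x => \prod_(i <- [::] | P i) F i x) = (fun=> 1).
    by apply/funext => x; rewrite big_nil.
  by move=> x; exact: cvg_cst.
have [Pi|nPi] := boolP (P i).
  have -> : (fun x => \prod_(j <- i :: r | P j) F j x) =
      (fun x => F i x * \prod_(j <- r | P j) F j x).
    by apply/funext => x; rewrite big_cons Pi.
  by move=> x; apply: cvgM; [exact: cF|exact: IH].
suff -> : (fun x => \prod_(j <- i :: r | P j) F j x) =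
    (fun x => \prod_(j <- r | P j) F j x) by [].
by apply/funext => x; rewrite big_cons (negbTE nPi).
Qed.

Lemma continuous_det (T : topologicalType) (p : nat) (M : T -> 'M[R]_p) :
  (forall i j, continuous (fun x => M x i j)) ->
  continuous (fun x => \det (M x)).
Proof.
move=> cM; apply: continuous_bigsum => s x.
apply: cvgM; first exact: cvg_cst.
have cP := @continuous_bigprod T _ (index_enum 'I_p) xpredT
  (fun i (y : T) => M y i (s i)).
by apply: cP => i; exact: cM.
Qed.

Lemma continuous_invmx (T : topologicalType) (p : nat) (M : T -> 'M[R]_p) :
  (forall i j, continuous (fun x => M x i j)) ->
  (forall x, M x \in unitmx) ->
  forall i j, continuous (fun x => invmx (M x) i j).
Proof.
move=> cM uM i j.
have -> : (fun x => invmx (M x) i j) =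
    (fun x => (\det (M x))^-1 * cofactor (M x) j i).
  by apply/funext => x; rewrite /invmx uM !mxE.
move=> x; apply: cvgM.
  apply: cvgV; last exact: continuous_det.
  by have := uM x; rewrite unitmxE unitfE.
apply: cvgM; first exact: cvg_cst.
have cD := @continuous_det T _ (fun y => row' j (col' i (M y))).
by apply: cD => k l; under eq_fun do rewrite !mxE; exact: cM.
Qed.

(* Tuples carry no topology; continuity is tested on row vectors. *)
Definition row_tuple n (x : 'rV[R]_n) : n.-tuple (measurableTypeR R) :=
  [tuple x ord0 k | k < n].

Definition tuple_continuous n (f : n.-tuple (measurableTypeR R) -> R) :=
  continuous (f \o @row_tuple n).

Section TupleContinuous.
Context {n : nat}.
Implicit Types f g : n.-tuple (measurableTypeR R) -> R.

Lemma tuple_continuous_ext f g : f =1 g -> tuple_continuous f -> tuple_continuous g.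
Proof. by move=> /funext ->. Qed.

Lemma tuple_continuous_cst (c : R) :
  tuple_continuous (fun _ : n.-tuple (measurableTypeR R) => c).
Proof. by rewrite /tuple_continuous (_ : _ \o _ = cst c) //; exact: cst_continuous. Qed.

Lemma tuple_continuous_tnth (k : 'I_n) :
  tuple_continuous (fun a : n.-tuple (measurableTypeR R) => tnth a k : R).
Proof.
rewrite /tuple_continuous (_ : _ \o _ = (fun x : 'rV[R]_n => x ord0 k)).
  by move=> x; exact: coord_continuous.
by apply/funext => x; rewrite /= tnth_mktuple.
Qed.

Lemma tuple_continuousD f g :
  tuple_continuous f -> tuple_continuous g -> tuple_continuous (fun a => f a + g a).
Proof. by move=> cf cg x; exact: (cvgD (cf x) (cg x)). Qed.

Lemma tuple_continuousM f g :
  tuple_continuous f -> tuple_continuous g -> tuple_continuous (fun a => f a * g a).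
Proof. by move=> cf cg x; exact: (cvgM (cf x) (cg x)). Qed.

Lemma tuple_continuousV f : (forall a, f a != 0) ->
  tuple_continuous f -> tuple_continuous (fun a => (f a)^-1).
Proof. by move=> f0 cf x; exact: (cvgV (f0 _) (cf x)). Qed.

Lemma tuple_continuous_sqrt f :
  tuple_continuous f -> tuple_continuous (fun a => Num.sqrt (f a)).
Proof.
move=> cf x; apply: (@continuous_comp _ _ _ (f \o @row_tuple n) Num.sqrt).
  exact: cf.
exact: sqrt_continuous.
Qed.

Lemma tuple_continuous_sum (I : Type) (r : seq I) (F : I -> _ -> R) :
  (forall i, tuple_continuous (F i)) ->
  tuple_continuous (fun a : n.-tuple (measurableTypeR R) => \sum_(i <- r) F i a).
Proof.
move=> cF.
exact: (@continuous_bigsum _ I r xpredT (fun i => F i \o @row_tuple n)).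
Qed.

End TupleContinuous.

End ContinuityOnTuples.

(** * The edges of a path as a set of coordinates *)

Section PathEdges.
Context {p : nat} (e : rel 'I_p).
Implicit Types (u v : 'I_p) (s : seq 'I_p).

(** A set rather than an index: it ignores the orientation and is empty when there is no edge, so
    [path_edges] needs no proof that its argument is a path. *)
Definition edge_index u v : {set 'I_#|{: edge e}|} :=
  [set k | (val (enum_val k) == (u, v)) || (val (enum_val k) == (v, u))].

Fixpoint path_edges u s : {set 'I_#|{: edge e}|} :=
  if s is v :: s' then edge_index u v :|: path_edges v s' else finset.set0.

Lemma edge_index1 u v : topologically_ordered e -> skeleton e u v ->
  exists2 k, edge_index u v = [set k]%SET &
    val (enum_val k) = (u, v) \/ val (enum_val k) = (v, u).
Proof.
move=> eo.
suff wl u' v' : e u' v' -> exists2 k, edge_index u' v' = [set k]%SET &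
    val (enum_val k) = (u', v') \/ val (enum_val k) = (v', u').
  move=> /orP[/wl//|/wl[k kE kuv]]; exists k; last by case: kuv; [right|left].
  by rewrite -kE; apply/setP => l; rewrite !inE orbC.
move=> euv; pose E : edge e := exist _ (u', v') euv.
exists (enum_rank E); last by left; rewrite enum_rankK.
apply/setP => k; rewrite !inE.
have -> : (k == enum_rank E) = (val (enum_val k) == (u', v')).
  by rewrite -(inj_eq enum_val_inj) enum_rankK -val_eqE.
apply: orb_idr => /eqP h; have := valP (enum_val k); rewrite h /= => evu.
by have := ltn_trans (eo _ _ euv) (eo _ _ evu); rewrite ltnn.
Qed.

Lemma path_edges_mem u s k : k \in path_edges u s ->
  (val (enum_val k)).1 \in u :: s /\ (val (enum_val k)).2 \in u :: s.
Proof.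
elim: s u => [|v s IH] u; first by rewrite inE.
rewrite [path_edges _ _]/= inE => /orP[|/IH[h1 h2]].
  by rewrite inE => /orP[/eqP ->|/eqP ->]; rewrite !inE !eqxx ?orbT.
by rewrite !(in_cons u) h1 h2 !orbT.
Qed.

Lemma path_edges_notin u v s k :
  u \notin v :: s -> k \in edge_index u v -> k \notin path_edges v s.
Proof.
move=> us; rewrite inE => /orP[/eqP kE|/eqP kE]; apply/negP => /path_edges_mem;
  rewrite kE /= => -[h1 h2].
- by rewrite h1 in us.
- by rewrite h2 in us.
Qed.

Lemma card_path_edges u s : topologically_ordered e ->
  undirected_path e u s -> #|path_edges u s| = size s.
Proof.
move=> eo; rewrite /undirected_path; elim: s u => [|v s IH] u.
  by rewrite cards0.
move=> /= /andP[/andP[euv vs] /and3P[us vns uqs]].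
have [k kE _] := edge_index1 eo euv.
rewrite kE cardsU1 IH /=; last by rewrite vs vns.
by rewrite (path_edges_notin us) // kE inE.
Qed.

End PathEdges.

(** * Conditional covariances on a tree as products over path edges *)

Section PathFactorization.
Context {R : realType} {p : nat} (e : rel 'I_p).
Hypotheses (eo : topologically_ordered e) (et : tree_dag e).
Implicit Types (a : params R e) (u v i j : 'I_p) (B S : {set 'I_p}).

Lemma coef_matrix_eq0 a i j : ~~ e i j -> coef_matrix a i j = 0.
Proof.
move=> nij; by rewrite mxE; case: insubP => //= E h _; rewrite h in nij.
Qed.

Lemma coef_matrix_edge a k :
  coef_matrix a (val (enum_val k)).1 (val (enum_val k)).2 = tnth a k.
Proof.
rewrite mxE; case: insubP => [E /= _ h|].
  have -> : E = enum_val k.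
    by apply: val_inj; apply: etrans h _; rewrite -surjective_pairing.
  by rewrite enum_valK.
by rewrite -surjective_pairing; have := valP (enum_val k) => ->.
Qed.

(** The quadratic terms [a_ik a_jk] vanish: in a tree DAG two distinct nodes have no common
    child. *)
Lemma concentration_offdiag a i j : i != j ->
  concentration a i j = - (coef_matrix a i j + coef_matrix a j i).
Proof.
move=> ij; rewrite mxE.
under eq_bigr => k _.
  rewrite [X in X * _]mxE [X in _ * X]mxE [X in _ * X]mxE.
  rewrite [X in (_ + X) * _]mxE [X in _ * (_ + X)]mxE.
  rewrite [X in (_ - X) * _]mxE [X in _ * (_ - X)]mxE.
  rewrite mulrBl !mulrBr.
  over.
have AA k : coef_matrix a i k * coef_matrix a j k = 0.
  have [eik|/coef_matrix_eq0 ->] := boolP (e i k); last by rewrite mul0r.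
  have [ejk|/coef_matrix_eq0 ->] := boolP (e j k); last by rewrite mulr0.
  by have := parent_unique eo et eik ejk => /eqP; rewrite (negbTE ij).
have dd k : (i == k)%:R * (j == k)%:R = 0 :> R.
  case: eqVneq => [<-|_]; last by rewrite mul0r.
  by rewrite eq_sym (negbTE ij) mulr0.
under eq_bigr => k _ do rewrite AA dd sub0r subr0.
rewrite big_split /= !sumrN opprD; congr (- _ - _).
  rewrite (bigD1 j) //= eqxx mulr1 big1 ?addr0 // => k kj.
  by rewrite eq_sym (negbTE kj) mulr0.
rewrite (bigD1 i) //= eqxx mul1r big1 ?addr0 // => k kj.
by rewrite eq_sym (negbTE kj) mul0r.
Qed.

Lemma concentration_skeleton a i j : i != j -> concentration a i j != 0 ->
  skeleton e i j.
Proof.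
move=> ij; rewrite concentration_offdiag //; apply: contraNT.
rewrite negb_or => /andP[h1 h2].
by rewrite !coef_matrix_eq0 // addr0 oppr0.
Qed.

Lemma concentration_edge a u v : skeleton e u v ->
  `|concentration a u v| = \prod_(k in edge_index e u v) `|(tnth a k : R)|.
Proof.
move=> euv.
have uv : u != v by apply: contraTneq euv => ->; rewrite /skeleton /= orbb;
  apply/negP => /eo; rewrite ltnn.
have [k -> kE] := edge_index1 eo euv; rewrite big_set1 concentration_offdiag //.
have A0 x y : e x y -> coef_matrix a y x = 0.
  move=> exy; apply: coef_matrix_eq0; apply/negP => eyx.
  by have := ltn_trans (eo exy) (eo eyx); rewrite ltnn.
have := coef_matrix_edge a k; have := valP (enum_val k).
case: kE => -> /= exy <-.
  by rewrite (A0 _ _ exy) addr0 normrN.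
by rewrite (A0 _ _ exy) add0r normrN.
Qed.

(** By the topological order [N] is triangular with diagonal [-1], hence invertible, and the
    quadratic form is the squared norm of [x *m N]. *)
Lemma concentration_positive_definite a : positive_definite (concentration a).
Proof.
move=> x x0; set N := coef_matrix a - 1%:M.
have -> : x *m concentration a *m x^T = (x *m N) *m (x *m N)^T.
  by rewrite trmx_mul !mulmxA.
apply: row_norm2_gt0; apply: contra x0 => /eqP xN.
have NE k l : N k l = coef_matrix a k l - (k == l)%:R.
  by rewrite [LHS]mxE; congr (_ + _); rewrite [LHS]mxE [X in - X]mxE.
have up (k l : 'I_p) : (k <= l)%N -> coef_matrix a l k = 0.
  move=> kl; apply: coef_matrix_eq0; apply/negP => /eo.
  by rewrite ltnNge kl.
have uN : N \in unitmx.
  rewrite unitmxE -det_tr det_trig.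
    rewrite unitfE; apply/prodf_neq0 => k _.
    by rewrite mxE NE up // eqxx sub0r oppr_eq0 oner_eq0.
  apply/is_trig_mxP => k l kl.
  by rewrite mxE NE up ?(ltnW kl) // -val_eqE /= gtn_eqF // subr0.
by rewrite -(mulmxK uN x) xN mul0mx.
Qed.

Lemma tuple_continuous_concentration i j :
  tuple_continuous (fun a : params R e => concentration a i j).
Proof.
have cc u v : tuple_continuous (fun a : params R e => (coef_matrix a - 1%:M) u v).
  apply: (@tuple_continuous_ext _ _
    (fun a => (if (insub (u, v) : option (edge e)) is Some ij
                 then tnth a (enum_rank ij) : R else 0) + - (u == v)%:R)).
    by move=> a; rewrite !mxE.
  apply: tuple_continuousD; last exact: tuple_continuous_cst.
  case: insub => [ij|]; [exact: tuple_continuous_tnth|exact: tuple_continuous_cst].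
apply: (@tuple_continuous_ext _ _
  (fun a => \sum_k (coef_matrix a - 1%:M) i k * (coef_matrix a - 1%:M) j k)).
  by move=> a; rewrite [RHS]mxE; apply: eq_bigr => k _; rewrite [X in _ = _ * X]mxE.
by apply: tuple_continuous_sum => k; exact: tuple_continuousM.
Qed.

(** On [B] this is the covariance matrix of the variables in [B] conditional on all others. *)
Definition cond_cov B a : 'M[R]_p := invmx (restrict_mx B (concentration a)).

Lemma restrict_concentration_unitmx B a :
  restrict_mx B (concentration a) \in unitmx.
Proof.
apply/positive_definite_unitmx/positive_definite_restrict.
exact: concentration_positive_definite.
Qed.

Lemma cond_cov_diag_gt0 B a i : 0 < cond_cov B a i i.
Proof.
apply/positive_definite_inv_gt0/positive_definite_restrict.
exact: concentration_positive_definite.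
Qed.

Lemma tuple_continuous_cond_cov B i j :
  tuple_continuous (fun a => cond_cov B a i j).
Proof.
have ci := @continuous_invmx R _ p
  (fun y => restrict_mx B (concentration (row_tuple y : params R e))).
apply: ci => [u v|y]; last exact: restrict_concentration_unitmx.
change (tuple_continuous
  (fun a : params R e => restrict_mx B (concentration a) u v)).
apply: (@tuple_continuous_ext _ _ (fun a : params R e =>
  if (u \in B) && (v \in B) then concentration a u v else (u == v)%:R)).
  by move=> a; rewrite [RHS]mxE.
case: (_ && _); first exact: tuple_continuous_concentration.
exact: tuple_continuous_cst.
Qed.

Lemma cond_cov_path B v s : undirected_path e v s -> {subset v :: s <= B} ->
  exists w : params R e -> R, [/\ tuple_continuous w, forall a, 0 < w a &
    forall a, `|cond_cov B a v (last v s)| =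
      \prod_(k in path_edges e v s) `|(tnth a k : R)| * w a].
Proof.
rewrite /undirected_path; elim: s v => [|v1 s IH] v0.
  move=> _ _; exists (fun a => cond_cov B a v0 v0); split.
  - exact: tuple_continuous_cond_cov.
  - by move=> a; exact: cond_cov_diag_gt0.
  - by move=> a; rewrite big_set0 mul1r gtr0_norm // cond_cov_diag_gt0.
move=> /andP[/= /andP[e01 p1] /andP[v0s us]] sB.
have v01 : v0 != v1 by apply: contraNneq v0s => ->; exact: mem_head.
pose W := [set u | connect (skeleton_minus e v0 v1) v0 u]%SET.
pose C := B :&: W.
have sB1 : {subset v1 :: s <= B}.
  by move=> u us'; apply: sB; rewrite inE us' orbT.
have pus1 : path (skeleton e) v1 s && uniq (v1 :: s) by rewrite p1.
have [w [cw w0 wE]] := IH v1 pus1 sB1.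
have v1W : v1 \notin W by rewrite inE bridge //; case: et.
have jW : last v1 s \notin W.
  rewrite inE; apply: contra v1W => v0j; rewrite inE.
  apply: connect_trans v0j _.
  have cs : connect_sym (skeleton_minus e v0 v1).
    apply: sym_connect_sym => x y.
    rewrite /skeleton_minus /= skeleton_sym; congr (_ && _).
    by rewrite andbC !xpair_eqE; congr (~~ _ && ~~ _); exact: andbC.
  (* The rest of the path avoids [v0], so it never uses the cut edge and its end stays on the side
     of [v1]. *)
  rewrite cs; apply/connectP; exists s => //.
  apply: (sub_in_path (P := predC1 v0)) p1 => [x y /= xv0 yv0 exy|].
    by rewrite /skeleton_minus /= exy !xpair_eqE (negbTE xv0) (negbTE yv0) andbF.
  by apply/allP => x xs /=; apply: contraNneq v0s => <-.
exists (fun a => cond_cov C a v0 v0 * w a); split.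
- by apply: tuple_continuousM => //; exact: tuple_continuous_cond_cov.
- by move=> a; rewrite mulr_gt0 // cond_cov_diag_gt0.
move=> a /=.
have v0B : v0 \in B by apply: sB; exact: mem_head.
have v1B : v1 \in B by apply: sB; rewrite !inE eqxx orbT.
have jB : last v1 s \in B by apply: sB; rewrite inE mem_last orbT.
rewrite /cond_cov (@restrict_inv_step _ _ B C _ v0 v1).
- rewrite !normrM normrN (concentration_edge _ e01) -/(cond_cov B a) wE.
  rewrite -/(cond_cov C a) (gtr0_norm (cond_cov_diag_gt0 _ _ _)).
  have [k kE _] := edge_index1 eo e01.
  rewrite kE big_set1 [in RHS]big_setU1 /=.
    by rewrite !mulrA (mulrAC _ _ (\prod_(_ in _) _)).
  by apply: (path_edges_notin v0s); rewrite kE inE.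
- by apply/fintype.subsetP => x; rewrite inE => /andP[].
- exact: restrict_concentration_unitmx.
- exact: restrict_concentration_unitmx.
- by rewrite inE v0B inE connect0.
- by rewrite inE v1B inE v1B (negbTE v1W).
- by rewrite inE jB inE jB (negbTE jW).
(* A nonzero entry between the side of [v0] and the rest of [B] is an edge of the skeleton. Were it
   not the cut edge, it would put [x] on the side of [v0]. *)
move=> u x; rewrite inE => /andP[uB uW]; rewrite inE inE negb_and => /andP[h xB] Kux.
have xW : x \notin W by case/orP: h; rewrite ?xB.
have ux : u != x by apply: contraNneq xW => <-.
have eux := concentration_skeleton ux Kux.
have [[-> ->]//|n1] := eqVneq (u, x) (v0, v1).
have [[uv xv]|n2] := eqVneq (u, x) (v1, v0); first by rewrite uv (negbTE v1W) in uW.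
move: xW; rewrite inE; move: uW; rewrite inE => v0u /negP[].
by apply: connect_trans v0u (connect1 _); rewrite /skeleton_minus /= eux n1 n2.
Qed.

Lemma corr_path i j S s : i != j -> d_connecting e i j S s ->
  exists u : params R e -> R, [/\ tuple_continuous u, forall a, 0 < u a &
    forall a, `|corr a i j S| =
      \prod_(k in path_edges e i s) `|(tnth a k : R)| * u a].
Proof.
move=> ij [ps sj sS]; pose B := ~: S.
have sB : {subset i :: s <= B}.
  move=> x /(nthP i)[k ks <-]; have := sS k ks => /=.
  by rewrite (negbTE (no_collider k eo et ps)) inE.
have iB : i \in B by apply: sB; exact: mem_head.
have jB : j \in B by apply: sB; rewrite -sj; exact: mem_last.
have [w [cw w0 wE]] := cond_cov_path ps sB.
exists (fun a => w a / Num.sqrt (cond_cov B a i i * cond_cov B a j j)).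
have d0 a : 0 < cond_cov B a i i * cond_cov B a j j.
  by rewrite mulr_gt0 // cond_cov_diag_gt0.
split.
- apply: tuple_continuousM => //; apply: tuple_continuousV.
    by move=> a; rewrite sqrtr_eq0 -ltNge d0.
  apply: tuple_continuous_sqrt.
  by apply: tuple_continuousM; exact: tuple_continuous_cond_cov.
- by move=> a; rewrite divr_gt0 // sqrtr_gt0.
move=> a; rewrite mulrA -wE sj /corr.
have -> : ~: (S :|: [set i; j]) = B :\: [set i; j].
  by apply/setP => x; rewrite !inE negb_or andbC.
have [d [dn0 mij mii mjj]] :=
  minors_restrict_inv iB jB ij (restrict_concentration_unitmx B a).
rewrite normrM normfV (ger0_norm (sqrtr_ge0 _)) mij mii mjj -/(cond_cov B a).
(* The common scale [d] of the minors enters the numerator once and the denominator as the root of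
   [d ^+ 2]; in absolute value it cancels. *)
have -> : d * cond_cov B a j j * (d * cond_cov B a i i) =
    d ^+ 2 * (cond_cov B a i i * cond_cov B a j j) by ring.
rewrite sqrtrM ?sqr_ge0 // sqrtr_sqr normrM invfM mulrACA divff ?mul1r //.
by rewrite normr_eq0.
Qed.

End PathFactorization.

(** * Volume of product sublevel sets *)

Section ProductVolume.
Context {R : realType}.
Implicit Types (k : nat) (s t x y : R).
Let leb := @lebesgue_measure R.

(** Differentiation lowers [k] by one, so integration against [dx / x] raises it by one: this is how
    each further coordinate adds a power of the logarithm. *)
Definition trunc_exp k y : R := \sum_(j < k) y ^+ j / j`!%:R.

Lemma trunc_exp0 k : trunc_exp k.+1 0 = 1.
Proof.
rewrite /trunc_exp big_ord_recl /= expr0 fact0 divr1 big1 ?addr0 // => j _.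
by rewrite /bump add1n exprS !mul0r.
Qed.

Lemma is_derive_trunc_exp k y : is_derive y 1 (trunc_exp k.+1) (trunc_exp k y).
Proof.
elim: k => [|k IH].
  have -> : trunc_exp 1 = cst 1.
    by apply/funext => x; rewrite /trunc_exp big_ord1 expr0 fact0 divr1.
  by rewrite /trunc_exp big_ord0; exact: is_derive_cst.
have -> : trunc_exp k.+2 =
    trunc_exp k.+1 + (k.+1)`!%:R^-1 *: ((@id R) ^+ k.+1 : R -> R).
  apply/funext => x; rewrite {1}/trunc_exp big_ord_recr /=.
  rewrite fctE; congr (_ + _); rewrite mulrC.
  by rewrite /GRing.scale /=; congr (_ * _); elim: k.+1 => // n IHn;
    rewrite !exprS IHn.
have h := is_deriveD IH
  (is_deriveZ ((k.+1)`!%:R^-1) (is_deriveX k.+1 (is_derive_id y 1))).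
apply: is_derive_eq h _.
rewrite [in RHS]/trunc_exp big_ord_recr /=; congr (_ + _).
rewrite /GRing.scale /= mulr1 factS natrM invfM -mulrA [RHS]mulrC mulrCA.
by rewrite mulKf // pnatr_eq0.
Qed.

Lemma continuous_trunc_exp k : continuous (trunc_exp k).
Proof.
apply: continuous_bigsum => j x.
by apply: cvgM; [exact: exprn_continuous|exact: cvg_cst].
Qed.

(* [prod_volume k t s] is the volume of [{x in [0,1]^k | x_1 ... x_k * s <= t}]
   for [t > 0] and [s >= 0]. *)
Definition prod_volume k t s : R :=
  if t < s then t / s * trunc_exp k (ln s - ln t) else 1.

Lemma prod_volume_ge0 k t s : 0 < t -> 0 <= prod_volume k t s.
Proof.
move=> t0; rewrite /prod_volume; case: ifPn => // ts.
have s0 := lt_trans t0 ts.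
rewrite mulr_ge0 ?divr_ge0 ?(ltW t0) ?(ltW s0) // sumr_ge0 // => j _.
by rewrite divr_ge0 ?exprn_ge0 ?ler0n // subr_ge0 ler_ln ?posrE // (ltW ts).
Qed.

Lemma prod_volume_scale k t s : 0 < t -> 0 < s ->
  prod_volume k t s = prod_volume k (t / s) 1.
Proof.
move=> t0 s0; rewrite /prod_volume ltr_pdivrMr // mul1r divr1 ln1 sub0r.
by rewrite lnM ?posrE ?invr_gt0 // lnV ?posrE // opprD opprK addrC.
Qed.

Let f k t x := t / x * trunc_exp k (ln x - ln t).

Let f_cont k t x : 0 < x -> {for x, continuous (f k t)}.
Proof.
move=> x0; apply: cvgM.
  by apply: cvgM; [exact: cvg_cst|apply: cvgV => //; rewrite gt_eqF].
apply: (@continuous_comp _ _ _ (fun y => ln y - ln t) (trunc_exp k)).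
  by apply: cvgB; [exact: continuous_ln|exact: cvg_cst].
exact: continuous_trunc_exp.
Qed.

Let F k t x := t * trunc_exp k.+1 (ln x - ln t).

Let F_derive k t x : 0 < x -> is_derive x 1 (F k t) (f k t x).
Proof.
move=> x0.
have dl : is_derive x 1 (fun y => ln y - ln t) (x^-1 - 0).
  by apply: is_deriveB; exact: is_derive1_ln.
have h := is_deriveZ t
  (@is_derive1_comp _ (trunc_exp k.+1) (fun y => ln y - ln t) x _ _
    (is_derive_trunc_exp k (ln x - ln t)) dl).
apply: is_derive_eq h _.
by rewrite subr0 /f /GRing.scale /= mulrA mulrAC.
Qed.

Let f_cont_itv k t : 0 < t -> {within `[t, 1], continuous (f k t)}.
Proof.
move=> t0; apply: continuous_in_subspaceT => x.
rewrite inE /= in_itv /= => /andP[tx _]; apply: f_cont; exact: lt_le_trans tx.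
Qed.

Lemma integral_log_part k t : 0 < t -> t < 1 ->
  (\int[leb]_(x in `[t, 1%R]) (t / x * trunc_exp k (ln x - ln t))%:E =
   (t * trunc_exp k.+1 (- ln t) - t)%:E)%E.
Proof.
move=> t0 t1; rewrite (@continuous_FTC2 _ (f k t) (F k t)) //.
- by rewrite -EFinB /F ln1 sub0r subrr trunc_exp0 mulr1.
- exact: f_cont_itv.
- have Fc x : 0 < x -> {for x, continuous (F k t)}.
    move=> x0; apply: differentiable_continuous; apply/derivable1_diffP.
    by have [] := F_derive k t x0.
  split.
  + move=> x; rewrite in_itv /= => /andP[tx _].
    by have [] := F_derive k t (lt_trans t0 tx).
  + by apply: cvg_at_right_filter; exact: Fc.
  + by apply: cvg_at_left_filter; exact: Fc.
- move=> x; rewrite in_itv /= => /andP[tx _].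
  rewrite derive1E; have [_] := F_derive k t (lt_trans t0 tx).
  exact.
Qed.

Let f_oppr_cont_itv k t : 0 < t ->
  {within `[-1, (- t)], continuous (f k t \o -%R)}.
Proof.
move=> t0; apply: continuous_in_subspaceT => x.
rewrite inE /= in_itv /= => /andP[_ xt].
apply: (@continuous_comp _ _ _ -%R (f k t)); first exact: opp_continuous.
by apply: f_cont; rewrite (lt_le_trans t0) // lerNr.
Qed.

(** The cuts are where the volume changes formula: it is 1 on the middle piece and given by [f] on
    the outer ones. *)
Let itv11_split t : 0 < t -> t < 1 ->
  `[-1, 1]%classic = `[-1, (- t)[%classic `|` `[(- t), t]%classic `|` `]t, 1]%classic.
Proof.
move=> t0 t1; have N1t : - 1 < - t by rewrite ltrN2.
have tt : - t < t by rewrite gtrN.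
rewrite -itv_bndbnd_setU ?bnd_simp ?(ltW N1t) ?(ltW tt) //.
by rewrite -itv_bndbnd_setU ?bnd_simp // ltW // (lt_trans N1t).
Qed.

Lemma measurable_prod_volume k t : 0 < t ->
  measurable_fun (`[-1, 1]%classic : set R) (fun x : R => prod_volume k t `|x|).
Proof.
move=> t0.
have m1 (D : set R) (mD : measurable D) : (forall x, D x -> `|x| <= t) ->
    measurable_fun D (fun x => prod_volume k t `|x|).
  move=> Dt.
  have E : {in D, (cst 1 : R -> R) =1 fun x => prod_volume k t `|x|}.
    by move=> x; rewrite inE => /Dt xt; rewrite /prod_volume ltNge xt.
  by apply: eq_measurable_fun E _; exact: measurable_cst.
have [t1|t1] := leP 1 t.
  apply: m1 => // x; rewrite /= in_itv /= -ler_norml => x1; exact: le_trans t1.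
have mR : measurable_fun `]t, 1] (fun x => prod_volume k t `|x|).
  have E : {in `]t, 1]%classic, f k t =1 fun x => prod_volume k t `|x|}.
    move=> x; rewrite inE /= in_itv /= => /andP[tx _].
    by rewrite /prod_volume gtr0_norm ?tx // (lt_trans t0 tx).
  apply: eq_measurable_fun E _.
  apply: measurable_funS (_ : measurable_fun `[t, 1] _) => //.
    exact: subset_itv_oc_cc.
  by apply: subspace_continuous_measurable_fun => //; exact: f_cont_itv.
have mL : measurable_fun `[-1, (- t)[ (fun x => prod_volume k t `|x|).
  have E : {in `[-1, (- t)[%classic, f k t \o -%R =1 fun x => prod_volume k t `|x|}.
    move=> x; rewrite inE /= in_itv /= => /andP[_ xt].
    have tx : t < - x by rewrite ltrNr.
    by rewrite /prod_volume ltr0_norm ?tx // -oppr_gt0 (lt_trans t0 tx).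
  apply: eq_measurable_fun E _.
  apply: measurable_funS (_ : measurable_fun `[-1, (- t)] _) => //.
    exact: subset_itv_co_cc.
  by apply: subspace_continuous_measurable_fun => //; exact: f_oppr_cont_itv.
have mM : measurable_fun `[(- t), t] (fun x => prod_volume k t `|x|).
  by apply: m1 => // x; rewrite /= in_itv /= -ler_norml.
rewrite (itv11_split t0 t1).
apply/measurable_funU => //; first exact: measurableU.
by split => //; apply/measurable_funU.
Qed.

(** This is the recursion in the dimension. For [t < 1] the middle piece contributes [2 * t] and
    each outer piece [t * trunc_exp k.+1 (- ln t) - t], since [F] is a primitive of [f]; the bare
    multiples of [t] cancel. *)
Lemma integral_prod_volume k t : 0 < t ->
  (\int[leb]_(x in `[(-1)%R, 1%R]) (prod_volume k t `|x|)%:E =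
   (2 * prod_volume k.+1 t 1)%:E)%E.
Proof.
move=> t0.
have leb_itv a b : a <= b -> leb `[a, b]%classic = (b - a)%:E.
  move=> ab; rewrite /leb lebesgue_measure_itv /= lte_fin.
  have [_|ba] := ltP a b; first by rewrite EFinB.
  by rewrite (@le_anti _ _ a b) ?ab // subrr.
have [t1|t1] := ltP t 1; last first.
  rewrite [in RHS]/prod_volume ltNge t1 /= mulr1.
  transitivity (\int[leb]_(x in `[(-1)%R, 1%R]) (cst 1%E x))%E.
    apply: eq_integral => x; rewrite inE /= in_itv /= -ler_norml => x1.
    by rewrite /prod_volume ltNge (le_trans x1 t1).
  rewrite integral_cst //= mul1e; apply: etrans (leb_itv (-1) 1 _) _; first by lra.
  by congr EFin; lra.
have tt : - t < t by rewrite gtrN.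
pose g x := prod_volume k t `|x|.
have gf x : t < x -> g x = f k t x.
  by move=> tx; rewrite /g /prod_volume gtr0_norm ?tx // (lt_trans t0 tx).
have gN x : g (- x) = g x by rewrite /g normrN.
have g1 x : `[(- t), t]%classic x -> g x = 1.
  by rewrite /= in_itv /= -ler_norml => xt; rewrite /g /prod_volume ltNge xt.
have mf : measurable_fun `[t, 1] (f k t).
  by apply: subspace_continuous_measurable_fun => //; exact: f_cont_itv.
have mfN : measurable_fun `[-1, (- t)] (f k t \o -%R).
  by apply: subspace_continuous_measurable_fun => //; exact: f_oppr_cont_itv.
have eqR : {in `]t, 1]%classic, f k t =1 g}.
  by move=> x; rewrite inE /= in_itv /= => /andP[tx _]; rewrite gf.
have eqL : {in `[-1, (- t)[%classic, f k t \o -%R =1 g}.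
  move=> x; rewrite inE /= in_itv /= => /andP[_ xt]; rewrite -(gN x) gf //.
  by rewrite ltrNr.
have mg : measurable_fun (`[-1, 1]%classic : set R) g by exact: measurable_prod_volume.
rewrite (itv11_split t0 t1) in mg *.
have mgLM : measurable_fun (`[-1, (- t)[ `|` `[(- t), t]) g.
  by move/measurable_funU : mg => -[] //; exact: measurableU.
have g0 x : (0 <= (g x)%:E)%E by rewrite lee_fin prod_volume_ge0.
have dis1 : [disjoint `[-1, (- t)[%classic & `[(- t), t]%classic].
  rewrite disj_set2E; apply/eqP/seteqP; split => // x [] /=; rewrite !in_itv /=.
  by move=> /andP[_ a] /andP[b _]; have := lt_le_trans a b; rewrite ltxx.
have dis2 : [disjoint `[-1, (- t)[%classic `|` `[(- t), t]%classic & `]t, 1]%classic].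
  rewrite disj_set2E; apply/eqP/seteqP; split => // x [] /=; rewrite !in_itv /=.
  move=> [/andP[_ a]|/andP[_ a]] /andP[b _].
    by have := lt_trans (lt_trans a tt) b; rewrite ltxx.
  by have := le_lt_trans a b; rewrite ltxx.
rewrite !ge0_integral_setU //; last 5 first.
- exact/measurable_EFinP.
- by move=> x _; exact: g0.
- exact: measurableU.
- exact/measurable_EFinP.
- by move=> x _; exact: g0.
have intR : (\int[leb]_(x in `]t, 1%R]) (g x)%:E =
   (t * trunc_exp k.+1 (- ln t) - t)%:E)%E.
  rewrite -integral_log_part // -integral_itv_obnd_cbnd; last first.
    apply/measurable_EFinP; apply: measurable_funS mf => //.
    exact: subset_itv_oc_cc.
  by apply: eq_integral => x xt; rewrite -eqR.
have intL : (\int[leb]_(x in `[(-1)%R, (- t)%R[) (g x)%:E =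
   (t * trunc_exp k.+1 (- ln t) - t)%:E)%E.
  rewrite -integral_log_part //.
  have := @integration_by_substitution_oppr _ (f k t \o -%R) t 1 (ltW t1).
  rewrite (_ : (f k t \o -%R) \o -%R = f k t); last first.
    by apply/funext => x /=; rewrite opprK.
  move=> <-; last first.
    exact: f_oppr_cont_itv.
  rewrite -integral_itv_bndo_bndc; last first.
    apply/measurable_EFinP; apply: measurable_funS mfN => //.
    exact: subset_itv_co_cc.
  by apply: eq_integral => x xt; rewrite -eqL.
rewrite intR intL.
have -> : (\int[leb]_(x in `[(- t)%R, t]) (g x)%:E = (t + t)%:E)%E.
  transitivity (\int[leb]_(x in `[(- t)%R, t]) (cst 1%E x))%E.
    by apply: eq_integral => x; rewrite inE => /g1 ->.
  rewrite integral_cst //= mul1e; apply: etrans (leb_itv (- t) t (ltW tt)) _.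
  by rewrite opprK.
rewrite -!EFinD; congr EFin.
by rewrite /prod_volume t1 ln1 sub0r divr1; ring.
Qed.

End ProductVolume.

(** * Volumes of product sublevel sets in boxes *)

Section BoxVolume.
Context {R : realType}.
Local Notation RB := (measurableTypeR R).
Let leb : {measure set RB -> \bar R} := @lebesgue_measure R.

Definition tprod n (P : {set 'I_n}) (a : n.-tuple RB) : R :=
  \prod_(k in P) `|tnth a k : R|.

Lemma tprod_ge0 n (P : {set 'I_n}) a : 0 <= tprod P a.
Proof. by rewrite prodr_ge0. Qed.

Lemma tprod_le1 n (P : {set 'I_n}) a :
  (forall k, k \in P -> `|tnth a k : R| <= 1) -> tprod P a <= 1.
Proof. by move=> h; rewrite prodr_ile1 // => k kP; rewrite normr_ge0 h. Qed.

Lemma measurable_tprod n (P : {set 'I_n}) :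
  measurable_fun [set: n.-tuple RB] (tprod P).
Proof.
have -> : tprod P = (fun a => \prod_(k <- enum P) `|tnth a k : R|).
  by apply/funext => a; rewrite /tprod big_enum.
apply: measurable_prod => k _; apply: measurableT_comp => //.
exact: measurable_tnth.
Qed.

Lemma measurable_box n (A : 'I_n -> set RB) : (forall k, measurable (A k)) ->
  measurable [set a : n.-tuple RB | forall k, A k (tnth a k)].
Proof.
move=> mA; rewrite (_ : mkset _ = \big[setI/setT]_(k < n)
    ((fun a : n.-tuple RB => tnth a k) @^-1` A k)).
  apply: bigsetI_measurable => k _.
  by rewrite -[X in measurable X]setTI; exact: measurable_tnth.
apply/seteqP; split => t.
  by move=> H; rewrite -bigcap_seq => k _; exact: H.
by rewrite -bigcap_seq => H k; apply: H; rewrite /= mem_index_enum.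
Qed.

Lemma measurable_tprod_le n (P : {set 'I_n}) t :
  measurable [set a : n.-tuple RB | tprod P a <= t].
Proof.
have := @measurable_tprod n P measurableT `]-oo, t]%classic (measurable_itv _).
by rewrite setTI (_ : _ @^-1` _ = [set a | tprod P a <= t]) //;
  apply/seteqP; split => a /=; rewrite in_itv.
Qed.

Lemma measurable_box_tprod n (A : 'I_n -> set RB) (P : {set 'I_n}) t :
  (forall k, measurable (A k)) ->
  measurable [set a | (forall k, A k (tnth a k)) /\ tprod P a <= t].
Proof.
move=> mA; apply: measurableI; first exact: measurable_box.
exact: measurable_tprod_le.
Qed.

(** The trace of [P] on the coordinates after the first, which the induction on the dimension splits
    off. *)
Let shrink n (P : {set 'I_n.+1}) : {set 'I_n} := [set k | lift ord0 k \in P]%SET.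

Let big_shrink (T : Type) (idx : T) (op : Monoid.law idx) n (P : {set 'I_n.+1})
    (F : 'I_n.+1 -> T) :
  \big[op/idx]_(k in P) F k = op (if ord0 \in P then F ord0 else idx)
    (\big[op/idx]_(k in shrink P) F (lift ord0 k)).
Proof.
rewrite big_mkcond big_ord_recl; congr (op _ _).
by rewrite [RHS]big_mkcond; apply: eq_bigr => k _; rewrite inE.
Qed.

Let big_shrinkC (T : Type) (idx : T) (op : Monoid.law idx) n (P : {set 'I_n.+1})
    (F : 'I_n.+1 -> T) :
  \big[op/idx]_(k | k \notin P) F k = op (if ord0 \in P then idx else F ord0)
    (\big[op/idx]_(k | k \notin shrink P) F (lift ord0 k)).
Proof.
rewrite big_mkcond big_ord_recl if_neg; congr (op _ _).
by rewrite [RHS]big_mkcond; apply: eq_bigr => k _; rewrite inE.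
Qed.

Let card_shrink n (P : {set 'I_n.+1}) : #|P| = ((ord0 \in P) + #|shrink P|)%N.
Proof. by rewrite -!sum1_card big_shrink; case: (_ \in P). Qed.

(** If coordinate 0 is not in [P], the set is a product. Otherwise its slice at [x] is the same kind
    of set one dimension lower, at level [t / |x|], and integrating over [x] is the one-dimensional
    recursion. *)
Lemma lebesgue_tuple_tprod n (A : 'I_n -> set RB) (P : {set 'I_n}) t :
  (forall k, measurable (A k)) ->
  (forall k, k \in P -> A k = `[-1, 1]%classic) -> 0 < t ->
  (@lebesgue_tuple R n [set a | (forall k, A k (tnth a k)) /\ (tprod P a <= t)%R] =
   \prod_(k | k \notin P) leb (A k) *
     (2 ^+ #|P| * prod_volume #|P| t 1)%:E)%E.
Proof.
elim: n A P t => [|n IH] A P t mA AP t0.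
  rewrite big1; last by case.
  have -> : #|P| = 0%N by apply: eq_card0 => -[].
  (* The empty product is 1, so the set is everything or nothing according to whether [1 <= t]; the
     empty sum [trunc_exp 0] gives the same values. *)
  rewrite expr0 mul1r mul1e /= diracE /prod_volume /trunc_exp big_ord0 mulr0.
  have tp : tprod P [tuple] = 1 by rewrite /tprod big1 //; case.
  case: ifPn => t1.
    rewrite memNset // => -[_]; rewrite tp leNgt t1 //.
  rewrite mem_set //; split; first by case.
  by rewrite tp leNgt.
pose A' k := A (lift ord0 k); pose P' := shrink P.
have mA' k : measurable (A' k) by exact: mA.
have AP' k : k \in P' -> A' k = `[-1, 1]%classic.
  by rewrite inE => /AP.
pose D' s := [set b : n.-tuple RB | (forall k, A' k (tnth b k)) /\ tprod P' b <= s].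
set D := [set a | _].
have consE x (b : n.-tuple RB) : D (cons_pair (x, b)) <->
    [/\ A ord0 x, forall k, A' k (tnth b k) &
     (if ord0 \in P then `|x : R| else 1) * tprod P' b <= t].
  have tE : tprod P (cons_pair (x, b)) =
      (if ord0 \in P then `|x : R| else 1) * tprod P' b.
    rewrite /tprod big_shrink; congr (_ * _).
    by apply: eq_bigr => k _; rewrite tnthS.
  have t0E : tnth (cons_pair (x, b)) ord0 = x by rewrite /cons_pair /= tnth0.
  have tSE k : tnth (cons_pair (x, b)) (lift ord0 k) = tnth b k.
    by rewrite /cons_pair /= tnthS.
  rewrite -tE; split=> [[h1 h2]|[h0 h1 h2]].
    split; [|move=> k|exact: h2].
      by move: (h1 ord0); rewrite t0E.
    by move: (h1 (lift ord0 k)); rewrite tSE.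
  split => // k; case: (unliftP ord0 k) => [j|] ->; last by rewrite t0E.
  by rewrite tSE; exact: h1.
have -> : (\prod_(k | k \notin P) leb (A k) =
    (if ord0 \in P then 1 else leb (A ord0)) *
    \prod_(k | k \notin P') leb (A' k))%E by exact: big_shrinkC.
rewrite /= /pushforward card_shrink -/P'.
case: ifPn => P0 in consE *; last first.
  have -> : @cons_pair R n @^-1` D = A ord0 `*` D' t.
    apply/seteqP; split => [[x b] /consE[h0 h1 h2]|[x b] [/= h0 [h1 h2]]].
      by split => //; split => //; rewrite mul1r in h2.
    by apply/consE; split => //; rewrite mul1r.
  rewrite product_measure1E //; last exact: measurable_box_tprod.
  by rewrite add0n -muleA -(IH A' P').
rewrite add1n mul1e /product_measure1.
set c := (\prod_(k | k \notin P') leb (A' k))%E.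
have c0 : (0 <= c)%E by rewrite prode_ge0.
transitivity (\int[leb]_(x in `[(-1)%R, 1%R])
    (c * (2 ^+ #|P'|)%:E * (prod_volume #|P'| t `|x : R|)%:E))%E.
  rewrite [RHS]integral_mkcond; apply: eq_integral => x _ /=.
  rewrite patchE; case: ifPn => [|]; last first.
    rewrite notin_setE => nx; rewrite (_ : xsection _ _ = set0) ?measure0 //.
    apply/seteqP; split => // b; rewrite /xsection /= inE => /consE[h0 _ _].
    by apply: nx; rewrite -(AP ord0).
  rewrite inE => x1.
  have x1' : `|x : R| <= 1 by move: x1; rewrite /= in_itv /= -ler_norml.
  have Dx s : (forall b, (forall k, A' k (tnth b k)) ->
      (`|x : R| * tprod P' b <= t) = (tprod P' b <= s)) ->
      xsection (@cons_pair R n @^-1` D) x = D' s.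
    move=> h; apply/seteqP; split => b; rewrite /xsection /= inE.
      by move=> /consE[h0 h1 h2]; split => //; rewrite -h.
    by move=> [h1 h2]; apply/consE; split => //; [rewrite AP|rewrite h].
  have [xt|xt] := leP `|x : R| t.
    (* For [|x| <= t] the constraint is void, as the remaining product is at most 1; it is written
       as level 1, which also covers [x = 0]. *)
    rewrite (Dx 1) ?IH //.
      by rewrite /prod_volume ltxx (ltNge t) xt /= mulr1 mule1.
    move=> b Ab; have b1 : tprod P' b <= 1.
      apply: tprod_le1 => k kP; have := Ab k; rewrite AP' //.
      by rewrite /= in_itv /= -ler_norml.
    by rewrite b1 (le_trans _ xt) // ler_piMr.
  have x0 : 0 < `|x : R| by exact: lt_trans xt.
  rewrite (Dx (t / `|x : R|)) ?IH ?divr_gt0 //.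
    by rewrite -prod_volume_scale // EFinM muleA.
  by move=> b _; rewrite ler_pdivlMr // mulrC.
rewrite ge0_integralZl //.
- rewrite -/leb integral_prod_volume // -muleA -EFinM; congr (_ * _%:E)%E.
  by rewrite exprS; ring.
- apply/measurable_EFinP; exact: measurable_prod_volume.
- by move=> x _; rewrite lee_fin prod_volume_ge0.
- by rewrite mule_ge0 // lee_fin exprn_ge0.
Qed.

End BoxVolume.

(** * Asymptotics of integrals over the cube *)

Section Asymptotics.
Context {R : realType}.
Implicit Types (k m : nat) (c : R).
Local Notation RB := (measurableTypeR R).

Definition log_scale m (lambda : R) : R := lambda * (- ln lambda) ^+ m.-1.

Lemma log_scale_gt0 m (lambda : R) : 0 < lambda -> lambda < 1 ->
  0 < log_scale m lambda.
Proof.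
by move=> l0 l1; rewrite mulr_gt0 // exprn_gt0 // oppr_gt0 ln_lt0 // l0.
Qed.

(** In terms of [v = 1 / (- ln lambda)] the quotient is [c * q v] for a polynomial [q], once
    [c * lambda < 1]. At [v = 0] only the term [j = m.-1] of [q] survives, and it is among the
    [j < k] exactly when [k = m]. *)
Lemma prod_volume_cvg k m c : (k <= m)%N -> (0 < m)%N -> 0 < c ->
  prod_volume k (c * lambda) 1 / log_scale m lambda @[lambda --> 0^'+] -->
    c * ((k == m)%:R / (m.-1)`!%:R).
Proof.
move=> km m0 c0.
pose q v := \sum_(j < k) (1 - ln c * v) ^+ j * v ^+ (m.-1 - j) / j`!%:R.
have q0 : q 0 = (k == m)%:R / (m.-1)`!%:R.
  rewrite /q mulr0 subr0.
  under eq_bigr do rewrite expr1n mul1r expr0n.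
  have [->|km'] := eqVneq k m.
    case: m m0 {km q} => // m _; rewrite big_ord_recr /= subnn eqxx big1 ?add0r //.
    by move=> j _; rewrite subn_eq0 leqNgt ltn_ord mul0r.
  have {}km : (k < m)%N by rewrite ltn_neqAle km'.
  rewrite mul0r big1 // => j _; rewrite subn_eq0 leqNgt.
  rewrite (_ : (j < m.-1)%N) ?mul0r //.
  by rewrite -ltnS prednK // (leq_ltn_trans _ km).
have qc : continuous q.
  pose F (j : 'I_k) v := (1 - ln c * v) ^+ j * v ^+ (m.-1 - j) / j`!%:R.
  apply: (@continuous_bigsum R _ _ (index_enum 'I_k) xpredT F) => j v.
  apply: cvgM; last exact: cvg_cst.
  apply: cvgM; last exact: exprn_continuous.
  apply: (@continuous_comp _ _ _ (fun v => 1 - ln c * v) (fun x => x ^+ j)).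
    apply: cvgB; first exact: cvg_cst.
    by apply: cvgM; [exact: cvg_cst|exact: cvg_id].
  exact: exprn_continuous.
have v0 : (- ln lambda)^-1 @[lambda --> (0:R)^'+] --> (0 : R).
  apply/gtr0_cvgV0; last first.
    by apply/cvgNry; exact: lnNy.
  near=> l; rewrite oppr_gt0 ln_lt0 //.
  by apply/andP; split; near: l; [exact: nbhs_right_gt|exact: nbhs_right_lt].
have qv : q (- ln lambda)^-1 @[lambda --> (0:R)^'+] --> q 0.
  by apply: cvg_comp v0 _; exact: qc.
have cqv : c * q (- ln lambda)^-1 @[lambda --> (0:R)^'+] --> c * q 0.
  by apply: cvgM qv; exact: cvg_cst.
rewrite -q0; move: cqv; apply: cvg_trans; apply: near_eq_cvg; near=> l.
have l0 : 0 < l by near: l; exact: nbhs_right_gt.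
have l1 : l < 1 by near: l; exact: nbhs_right_lt.
have lc : l < c^-1 by near: l; apply: nbhs_right_lt; rewrite invr_gt0.
have L0 : 0 < - ln l by rewrite oppr_gt0 ln_lt0 // l0.
have qE : q (- ln l)^-1 = trunc_exp k (- ln l - ln c) / (- ln l) ^+ m.-1.
  rewrite /q /trunc_exp mulr_suml; apply: eq_bigr => j _.
  rewrite [RHS]mulrAC; congr (_ / _).
  have -> : 1 - ln c * (- ln l)^-1 = (- ln l - ln c) / - ln l.
    by field; rewrite -oppr_eq0 gt_eqF.
  have jm : (j <= m.-1)%N by rewrite -ltnS prednK // (leq_trans _ km).
  rewrite expr_div_n exprVn -mulrA -invfM -exprD subnKC //.
have lnc : - ln (c * l) = - ln l - ln c.
  by rewrite lnM ?posrE // opprD addrC.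
rewrite /prod_volume -ltr_pdivlMl // mulr1 lc ln1 sub0r divr1 /log_scale.
rewrite /= lnc qE; field; rewrite expf_neq0 ?gt_eqF //.
Unshelve. all: by end_near.
Qed.


End Asymptotics.

(** * Limits of integrals over the cube after division by the logarithmic scale *)

Section AsymptoticIntegrals.
Context {R : realType} (n m : nat).
Hypothesis m0 : (0 < m)%N.
Local Notation RB := (measurableTypeR R).
Local Notation mu := (@lebesgue_tuple R n).
Implicit Types (f g : R -> n.-tuple RB -> R) (P Q : {set 'I_n}).

Definition ncube : set (n.-tuple RB) :=
  [set a | forall k, (tnth a k : R) \in `[-1, 1]].

Lemma ncube_norm a k : ncube a -> `|tnth a k : R| <= 1.
Proof. by move=> /(_ k); rewrite in_itv /= ler_norml. Qed.

Lemma ncube_tprod_le1 a P : ncube a -> tprod P a <= 1.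
Proof. by move=> ca; apply: tprod_le1 => k _; exact: ncube_norm. Qed.

Lemma measurable_ncube : measurable ncube.
Proof. exact: (@measurable_box R n (fun=> `[-1, 1]%classic)). Qed.

Lemma lebesgue_ncube_lty : (mu ncube < +oo)%E.
Proof.
have := @lebesgue_tuple_tprod R n (fun=> `[-1, 1]%classic) [set: 'I_n]%SET 1
  (fun=> measurable_itv _) (fun _ _ => erefl) ltr01.
rewrite (_ : [set a | _] = ncube).
  rewrite big1 => [->|k]; last by rewrite inE.
  by rewrite mul1e ltry.
apply/seteqP; split => [a [h _]|a ca]; first exact: h.
by split; [exact: ca|exact: ncube_tprod_le1].
Qed.

Lemma ncube_integrable (g : n.-tuple RB -> R) (M : R) :
  measurable_fun ncube g -> (forall a, ncube a -> `|g a| <= M) ->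
  mu.-integrable ncube (EFin \o g).
Proof.
move=> mg gM; apply: measurable_bounded_integrable => //.
- exact: measurable_ncube.
- exact: lebesgue_ncube_lty.
- exists M; split; first by rewrite num_real.
  by move=> x Mx a ca; apply: le_trans (gM _ ca) (ltW Mx).
Qed.

(** Integrability belongs to the predicate so that sums, multiples and comparisons of limits need no
    side conditions. *)
Definition asym f (l : R) :=
  (forall lambda, 0 < lambda -> mu.-integrable ncube (EFin \o f lambda)) /\
  (\int[mu]_(a in ncube) f lambda a) / log_scale m lambda
    @[lambda --> 0^'+] --> l.

Lemma asym0 : asym (fun _ _ => 0) 0.
Proof.
split=> [l _|].
  by apply: (@ncube_integrable _ 0) => [|a _]; [exact: measurable_cst|rewrite normr0].
rewrite (_ : (fun _ => _) = cst 0); first exact: cvg_cst.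
apply/funext => l; rewrite /= Rintegral_cst ?mul0r //.
exact: measurable_ncube.
Qed.

Lemma asymD f g l l' : asym f l -> asym g l' ->
  asym (fun lambda a => f lambda a + g lambda a) (l + l').
Proof.
move=> [If lf] [Ig lg]; split=> [x x0|].
  rewrite (_ : EFin \o _ = (EFin \o f x) \+ (EFin \o g x))%E //.
  by apply: integrableD; [exact: measurable_ncube|exact: If|exact: Ig].
have : (\int[mu]_(a in ncube) f lambda a) / log_scale m lambda +
    (\int[mu]_(a in ncube) g lambda a) / log_scale m lambda
    @[lambda --> 0^'+] --> l + l' by exact: cvgD.
apply: cvg_trans; apply: near_eq_cvg; near=> x.
have x0 : 0 < x by near: x; exact: nbhs_right_gt.
rewrite /= RintegralD ?mulrDl //; first exact: measurable_ncube.
  exact: If.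
exact: Ig.
Unshelve. all: by end_near.
Qed.

Lemma asymZ c f l : asym f l -> asym (fun lambda a => c * f lambda a) (c * l).
Proof.
move=> [If lf]; split=> [x x0|].
  rewrite (_ : EFin \o _ = (fun a => c%:E * (EFin \o f x) a)%E) //.
  by apply: integrableZl; [exact: measurable_ncube|exact: If].
have : c * ((\int[mu]_(a in ncube) f lambda a) / log_scale m lambda)
    @[lambda --> 0^'+] --> c * l by apply: cvgM lf; exact: cvg_cst.
apply: cvg_trans; apply: near_eq_cvg; near=> x.
have x0 : 0 < x by near: x; exact: nbhs_right_gt.
rewrite /= RintegralZl ?mulrA //; first exact: measurable_ncube.
exact: If.
Unshelve. all: by end_near.
Qed.

Lemma asym_sum (I : Type) (r : seq I) (D : pred I)
    (f : I -> R -> n.-tuple RB -> R) (l : I -> R) :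
  (forall i, D i -> asym (f i) (l i)) ->
  asym (fun lambda a => \sum_(i <- r | D i) f i lambda a)
    (\sum_(i <- r | D i) l i).
Proof.
move=> fl; elim: r => [|i r IH].
  rewrite big_nil (_ : (fun lambda a => _) = (fun _ _ => 0)); first exact: asym0.
  by apply/funext => x; apply/funext => a; rewrite big_nil.
rewrite big_cons; case: ifPn => Di.
  rewrite (_ : (fun lambda a => _) =
      (fun lambda a => f i lambda a + \sum_(j <- r | D j) f j lambda a)).
    by apply: asymD IH; exact: fl.
  by apply/funext => x; apply/funext => a; rewrite big_cons Di.
rewrite (_ : (fun lambda a => _) =
    (fun lambda a => \sum_(j <- r | D j) f j lambda a)) //.
by apply/funext => x; apply/funext => a; rewrite big_cons (negbTE Di).
Qed.

Lemma asym_le f g l l' : asym f l -> asym g l' ->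
  (\forall lambda \near 0^'+, forall a, ncube a -> f lambda a <= g lambda a) ->
  l <= l'.
Proof.
move=> [If lf] [Ig lg] fg; apply: ler_cvg_to lf lg _; near=> x.
have x0 : 0 < x by near: x; exact: nbhs_right_gt.
have x1 : x < 1 by near: x; exact: nbhs_right_lt.
rewrite ler_pM2r ?invr_gt0 ?log_scale_gt0 //; apply: le_Rintegral.
- exact: measurable_ncube.
- exact: If.
- exact: Ig.
- by near: x.
Unshelve. all: by end_near.
Qed.

(** The bounds may change with [eps], and no candidate for the limit is required: with tolerance
    [eps / 2] the quotient is eventually within [eps] of [l], which makes its limit filter
    Cauchy. *)
Lemma asym_squeeze f :
  (forall lambda, 0 < lambda -> mu.-integrable ncube (EFin \o f lambda)) ->
  (forall eps, 0 < eps -> exists lo up l u,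
    [/\ asym lo l, asym up u, u <= l + eps &
      \forall lambda \near 0^'+, forall a, ncube a ->
        lo lambda a <= f lambda a <= up lambda a]) ->
  exists l, asym f l.
Proof.
move=> If sq.
pose r lambda := (\int[mu]_(a in ncube) f lambda a) / log_scale m lambda.
suff : cvg (r lambda @[lambda --> 0^'+]) by move=> cr; exists (lim (r @ 0^'+)); split.
apply: cauchy_cvg; apply: cauchy_exP => eps eps0.
have e2 : 0 < eps / 2 by rewrite divr_gt0.
have [lo [up [l [u [[Il ll] [Iu lu] ul lfu]]]]] := sq _ e2.
exists l; rewrite /fmap /=; near=> x.
have x0 : 0 < x by near: x; exact: nbhs_right_gt.
have x1 : x < 1 by near: x; exact: nbhs_right_lt.
have h0 : 0 < (log_scale m x)^-1 by rewrite invr_gt0 log_scale_gt0.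
have H : forall a, ncube a -> lo x a <= f x a <= up x a by near: x.
have lox : `|l - (\int[mu]_(a in ncube) lo x a) / log_scale m x| < eps / 2.
  by near: x; exact: cvgr_dist_lt.
have upx : `|u - (\int[mu]_(a in ncube) up x a) / log_scale m x| < eps / 2.
  by near: x; exact: cvgr_dist_lt.
have h1 : (\int[mu]_(a in ncube) lo x a) / log_scale m x <= r x.
  rewrite ler_pM2r //.
  apply: le_Rintegral; [exact: measurable_ncube|exact: Il|exact: If|].
  by move=> a /H /andP[].
have h2 : r x <= (\int[mu]_(a in ncube) up x a) / log_scale m x.
  rewrite ler_pM2r //.
  apply: le_Rintegral; [exact: measurable_ncube|exact: If|exact: Iu|].
  by move=> a /H /andP[].
rewrite /ball /= ltr_norml; move: lox upx.
rewrite !ltr_norml => /andP[a1 a2] /andP[b1 b2].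
by apply/andP; split; lra.
Unshelve. all: by end_near.
Qed.

Definition box_term (A : 'I_n -> set RB) P c (lambda : R) : n.-tuple RB -> R :=
  \1_[set a | (forall k, A k (tnth a k)) /\ tprod P a <= c * lambda].

Lemma measurable_box_term (A : 'I_n -> set RB) P c lambda :
  (forall k, measurable (A k)) ->
  measurable_fun ncube (box_term A P c lambda).
Proof.
move=> mA; apply: measurable_funS (_ : measurable_fun setT _) => //.
apply: measurable_indic; exact: measurable_box_tprod.
Qed.

Lemma asym_box_term (A : 'I_n -> set RB) P c : (forall k, measurable (A k)) ->
  (forall k, A k `<=` `[-1, 1]) ->
  (forall k, k \in P -> A k = `[-1, 1]%classic) -> 0 < c -> (#|P| <= m)%N ->
  asym (box_term A P c)
    (\prod_(k | k \notin P) fine (lebesgue_measure (A k)) * 2 ^+ #|P| *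
      (c * ((#|P| == m)%:R / (m.-1)`!%:R))).
Proof.
move=> mA A1 AP c0 Pm.
have fA k : lebesgue_measure (A k) \is a fin_num.
  rewrite ge0_fin_numE //.
  apply: (@le_lt_trans _ _ (lebesgue_measure `[(-1 : R), 1]%classic)).
    by apply: le_measure; rewrite ?inE //; exact: A1.
  by rewrite lebesgue_measure_itv /= lte_fin; case: ifP; rewrite ?ltry.
split=> [x x0|].
  apply: (@ncube_integrable _ 1); first exact: measurable_box_term.
  by move=> a _; rewrite /box_term indicE; case: (_ \in _); rewrite ?normr1 ?normr0.
set v := \prod_(k | k \notin P) _.
have : v * 2 ^+ #|P| * (prod_volume #|P| (c * lambda) 1 / log_scale m lambda)
    @[lambda --> 0^'+] --> v * 2 ^+ #|P| * (c * ((#|P| == m)%:R / (m.-1)`!%:R)).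
  by apply: cvgM; [exact: cvg_cst|exact: prod_volume_cvg].
apply: cvg_trans; apply: near_eq_cvg; near=> x.
have x0 : 0 < x by near: x; exact: nbhs_right_gt.
rewrite /= mulrA; congr (_ / _).
rewrite /Rintegral integral_indic; last 2 first.
- exact: measurable_ncube.
- exact: measurable_box_tprod.
rewrite setIidl; last by move=> a [Aa _] k; apply: (A1 k); exact: Aa.
apply: (etrans _ (congr1 fine (esym (lebesgue_tuple_tprod mA AP (mulr_gt0 c0 x0))))).
rewrite (_ : (\prod_(k | k \notin P) _)%E = v%:E).
  by rewrite -EFinM /= mulrA.
rewrite /v (big_morph EFin (@EFinM R) erefl).
by apply: eq_bigr => k _; rewrite fineK.
Unshelve. all: by end_near.
Qed.

End AsymptoticIntegrals.

(** * Continuity on the cube and grids *)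

Section Grid.
Context {R : realType} (n : nat).
Local Notation RB := (measurableTypeR R).
Local Notation tup := (n.-tuple RB).
Local Notation Q := (@ncube R n).
Implicit Types (f : tup -> R) (N : nat).

Definition close (delta : R) (a b : tup) :=
  forall k, `|(tnth a k : R) - tnth b k| < delta.

(** Continuity relative to the cube, in coordinatewise distance, because the density is controlled
    on the cube alone. *)
Definition cube_continuous f := forall w, Q w -> forall eps, 0 < eps ->
  exists2 delta, 0 < delta &
    forall x, Q x -> close delta x w -> `|f x - f w| < eps.

Definition cube_unif_continuous f := forall eps, 0 < eps ->
  exists2 delta, 0 < delta &
    forall x y, Q x -> Q y -> close delta x y -> `|f x - f y| < eps.

Let row_of (a : tup) : 'rV[R]_n := \row_k (tnth a k : R).

Let row_ofK a : row_tuple (row_of a) = a.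
Proof. by apply: eq_from_tnth => k; rewrite tnth_mktuple mxE. Qed.

Let near_row (v : 'rV[R]_n) (delta : R) : 0 < delta ->
  \forall x \near v, forall k, `|(x : 'rV[R]_n) ord0 k - v ord0 k| < delta.
Proof.
move=> d0; apply/nbhs_ballP; exists delta => //= x [_ xv] k.
by have := xv ord0 k; rewrite /ball /= distrC.
Qed.

Lemma tuple_continuousW f : tuple_continuous f -> cube_continuous f.
Proof.
move=> cf w cw eps e0.
have := cf (row_of w) => /cvgr_dist_lt /(_ _ e0) /nbhs_ballP[d /= d0 H].
exists d => // x cx xw; have := H (row_of x); rewrite /= !row_ofK distrC; apply.
split => // i k; rewrite ord1 !mxE /ball /= distrC; exact: xw.
Qed.

Lemma cube_continuous_unif f : cube_continuous f -> cube_unif_continuous f.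
Proof.
move=> cf eps e0.
pose K : set 'rV[R]_n := [set v | forall i, `[-1, 1]%classic (v ord0 i)].
have cK : compact K.
  by apply: (@rV_compact R n (fun=> `[-1, 1]%classic)) => i; exact: segment_compact.
have KQ v : K v -> Q (row_tuple v).
  by move=> Kv k; rewrite tnth_mktuple; exact: Kv.
pose P (d : R) (v : 'rV[R]_n) := forall y, Q y -> close d (row_tuple v) y ->
  `|f (row_tuple v) - f y| < eps.
have : near_covering_within K by apply/near_covering_withinP/compact_near_coveringP.
move=> /(_ R (0 : R)^'+ P _) H.
have {H} : \forall d \near (0 : R)^'+, K `<=` P d.
  apply: H => v Kv.
  have e2 : 0 < eps / 2 by rewrite divr_gt0.
  have [d d0 fd] := cf _ (KQ _ Kv) _ e2.
  (* Half of the radius is for [x] and half for [y]: a [y] within [d / 2] of [x] is within [d] of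
     [v], and both values are compared with the one at [v]. *)
  have d2 : 0 < d / 2 by rewrite divr_gt0.
  exists ([set x : 'rV[R]_n | forall k, `|x ord0 k - v ord0 k| < d / 2],
          [set s | s < d / 2]) => /=.
    by split; [exact: near_row|exact: nbhs_right_lt].
  move=> [x s] /= [xv sd] Kx y Qy xy.
  have h1 : `|f (row_tuple x) - f (row_tuple v)| < eps / 2.
    apply: fd; first exact: KQ.
    move=> k; rewrite !tnth_mktuple; apply: lt_trans (xv k) _.
    by rewrite ltr_pdivrMr // ltr_pMr // ltr1n.
  have h2 : `|f y - f (row_tuple v)| < eps / 2.
    apply: fd => // k; rewrite tnth_mktuple.
    have := xy k; have := xv k; rewrite tnth_mktuple !ltr_norml.
    by move=> /andP[? ?] /andP[? ?]; apply/andP; split; lra.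
  move: h1 h2; rewrite !ltr_norml => /andP[? ?] /andP[? ?].
  by apply/andP; split; lra.
move=> H; have [d [d0 Hd]] : exists d, 0 < d /\ K `<=` P d.
  near (0 : R)^'+ => d; exists d; split; first by near: d; exact: nbhs_right_gt.
  by near: d.
exists d => // x y Qx Qy xy.
have Kx : K (row_of x) by move=> i; rewrite mxE; exact: Qx.
by have := Hd _ Kx y Qy; rewrite row_ofK; exact.
Unshelve. all: by end_near.
Qed.

Lemma cube_continuousV f : (forall a, Q a -> 0 < f a) ->
  cube_continuous f -> cube_continuous (fun a => (f a)^-1).
Proof.
move=> f0 cf w Qw eps e0; have fw := f0 _ Qw.
(* The first bound keeps [f x] above [f w / 2]; the second then puts [|f x - f w|] below
   [eps * (f x * f w)]. *)
pose eta := Num.min (f w / 2) (eps * (f w * f w) / 2).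
have eta0 : 0 < eta by rewrite lt_min !divr_gt0 ?mulr_gt0.
have [d d0 fd] := cf _ Qw _ eta0; exists d => // x Qx xw.
have fx := f0 _ Qx; have := fd _ Qx xw.
rewrite /eta lt_min => /andP[h1 h2].
have fx2 : f w / 2 < f x.
  by move: h1; rewrite ltr_norml => /andP[? ?]; lra.
have -> : (f x)^-1 - (f w)^-1 = (f w - f x) / (f x * f w).
  by field; rewrite !gt_eqF.
rewrite normrM distrC normfV (gtr0_norm (mulr_gt0 fx fw)) ltr_pdivrMr ?mulr_gt0 //.
apply: lt_le_trans h2 _.
rewrite -mulrA ler_pM2l // mulrAC mulrC [X in _ <= X]mulrC ler_pM2l //.
by rewrite ltW.
Qed.

(** Rounds [N * x] to a nearest integer, shifted by [N]. Through the summand [2^-1] the cells are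
    centred at the grid points, so 0 is interior to the middle cell and points of other cells
    satisfy [|x| >= 1 / (2 N)]. *)
Definition cell N (x : R) : 'I_(N.*2.+1) :=
  inord (Num.truncn (N%:R * x + N%:R + 2^-1)).

Definition center N (i : 'I_(N.*2.+1)) : R := (i%:R - N%:R) / N%:R.

Lemma cell_itv N x : `|x| <= 1 ->
  (cell N x)%:R <= N%:R * x + N%:R + 2^-1 < (cell N x)%:R + 1.
Proof.
move=> x1; set y := _ + _ + _.
have yN : 0 <= y < (N.*2.+1)%:R.
  have N0 : (0 : R) <= N%:R by [].
  move: x1; rewrite ler_norml => /andP[h1 h2].
  rewrite -addnn -addn1 !natrD /y; apply/andP; split.
    by have := ler_wpM2l N0 h1; lra.
  by have := ler_wpM2l N0 h2; lra.
have /andP[y0 yN'] := yN; have /andP[t1 t2] := truncn_itv y0.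
have tN : (Num.truncn y < N.*2.+1)%N by rewrite -(ltr_nat R) (le_lt_trans t1).
by rewrite inordK // t1 /= -[1]/(1%:R) -natrD addn1.
Qed.

Lemma center_norm N i : (0 < N)%N -> `|@center N i| <= 1.
Proof.
move=> N0; have N0' : (0 : R) < N%:R by rewrite ltr0n.
rewrite normrM normfV (gtr0_norm N0') ler_pdivrMr // mul1r ler_norml.
have : (i%:R : R) <= N%:R + N%:R by rewrite -natrD ler_nat addnn -ltnS.
have : (0 : R) <= i%:R by [].
by move=> h1 h2; apply/andP; split; lra.
Qed.

Lemma center_cell N x : (0 < N)%N -> `|x| <= 1 -> `|x - center (cell N x)| < N%:R^-1.
Proof.
move=> N0 /(@cell_itv N)/andP[h1 h2]; have N0' : (0 : R) < N%:R by rewrite ltr0n.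
rewrite /center.
have -> : x - ((cell N x)%:R - N%:R) / N%:R = (N%:R * x + N%:R - (cell N x)%:R) / N%:R.
  by field; rewrite gt_eqF.
rewrite normrM normfV (gtr0_norm N0') gtr_pMl ?invr_gt0 // ltr_norml.
by apply/andP; split; lra.
Qed.

Definition mid N : 'I_(N.*2.+1) := inord N.

Lemma cell_neq_mid N x : (0 < N)%N -> `|x| <= 1 -> cell N x != mid N ->
  (N.*2)%:R^-1 <= `|x|.
Proof.
move=> N0 x1; apply: contraNT; rewrite -ltNge => xN.
have N0' : (0 : R) < N%:R by rewrite ltr0n.
have /andP[h1 h2] := cell_itv N x1.
have NN : (N.*2)%:R = N%:R + N%:R :> R by rewrite -addnn natrD.
have h3 : `|N%:R * x| < 2^-1.
  rewrite normrM (gtr0_norm N0') -ltr_pdivlMl //.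
  apply: lt_le_trans xN _; rewrite NN.
  by rewrite (_ : N%:R + N%:R = N%:R * 2) ?invfM //; ring.
move: h3; rewrite ltr_norml => /andP[h3 h4].
apply/eqP/val_inj; rewrite /= (inordK (_ : N < N.*2.+1)%N); last first.
  by rewrite ltnS -addnn leq_addr.
apply/eqP; rewrite eqn_leq; apply/andP; split.
  by rewrite -ltnS -(ltr_nat R) -[N.+1]addn1 natrD; lra.
by rewrite -ltnS -(ltr_nat R) -[(cell N x).+1]addn1 natrD; lra.
Qed.

Definition cell_set N (i : 'I_(N.*2.+1)) : set RB :=
  [set x : R | (x \in `[-1, 1]) /\ cell N x = i].

Lemma measurable_cell_set N i : (0 < N)%N -> measurable (@cell_set N i).
Proof.
move=> N0; have N0' : (0 : R) < N%:R by rewrite ltr0n.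
rewrite (_ : cell_set i = `[-1, 1]%classic `&`
    `[(i%:R - N%:R - 2^-1) / N%:R, (i%:R + 1 - N%:R - 2^-1) / N%:R[%classic).
  by apply: measurableI; exact: measurable_itv.
apply/seteqP; split => x /=; rewrite !in_itv /= => -[x1].
  have x1' : `|x : R| <= 1 by move: x1; rewrite in_itv /= -ler_norml.
  move=> <-; have /andP[h1 h2] := cell_itv N x1'.
  rewrite -ler_norml; split => //.
  by rewrite ler_pdivrMr // ltr_pdivlMr //; apply/andP; split; lra.
rewrite ler_pdivrMr // ltr_pdivlMr // => /andP[h1 h2]; split; first by rewrite in_itv.
have := x1; rewrite -ler_norml => /(@cell_itv N)/andP[h3 h4].
apply/val_inj/eqP; rewrite eqn_leq; apply/andP; split.
  by rewrite -ltnS -(ltr_nat R) -[i.+1]addn1 natrD; lra.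
by rewrite -ltnS -(ltr_nat R) -[(cell N x).+1]addn1 natrD; lra.
Qed.

Definition cells N (a : tup) : {ffun 'I_n -> 'I_(N.*2.+1)} :=
  [ffun k => cell N (tnth a k : R)].

Definition grid_point N (beta : {ffun 'I_n -> 'I_(N.*2.+1)}) : tup :=
  [tuple center (beta k) | k < n].

Lemma grid_point_cube N beta : (0 < N)%N -> Q (@grid_point N beta).
Proof.
by move=> N0 k; rewrite tnth_mktuple in_itv /= -ler_norml center_norm.
Qed.

Lemma grid_point_close N a : (0 < N)%N -> Q a ->
  close N%:R^-1 a (grid_point (cells N a)).
Proof.
move=> N0 Qa k; rewrite tnth_mktuple ffunE; apply: center_cell => //.
exact: ncube_norm.
Qed.

Lemma grid_approx f : cube_unif_continuous f -> forall eps, 0 < eps ->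
  exists N0, forall N, (N0 <= N)%N -> (0 < N)%N ->
    forall a, Q a -> `|f a - f (grid_point (cells N a))| < eps.
Proof.
move=> uf eps e0; have [d d0 fd] := uf _ e0.
exists (Num.truncn d^-1).+1 => N N0 N1 a Qa; apply: fd => //.
  exact: grid_point_cube.
move=> k; apply: lt_le_trans (grid_point_close N1 Qa k) _.
rewrite -[d]invrK lef_pV2 ?posrE ?invr_gt0 ?ltr0n //.
have d1 : 0 <= d^-1 by rewrite invr_ge0 ltW.
have /andP[_ h] := truncn_itv d1.
by apply: le_trans (ltW h) _; rewrite ler_nat.
Qed.

(** On a fine grid [f] is within 1 of one of finitely many values, and the sum of their absolute
    values dominates each of them. *)
Lemma cube_bounded f : cube_continuous f ->
  exists2 M, 0 < M & forall a, Q a -> `|f a| <= M.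
Proof.
move=> /cube_continuous_unif /grid_approx /(_ 1 ltr01)[N0 HN].
pose N := N0.+1.
exists (\sum_(beta : {ffun 'I_n -> 'I_(N.*2.+1)}) `|f (grid_point beta)| + 1).
  by rewrite ltr_wpDl // sumr_ge0.
move=> a Qa; have := HN N (leqnSn _) isT a Qa.
set w := grid_point _ => h.
have : `|f w| <= \sum_(beta : {ffun 'I_n -> 'I_(N.*2.+1)}) `|f (grid_point beta)|.
  by rewrite (bigD1 (cells N a)) //= ler_wpDr // sumr_ge0.
rewrite -[f a](subrK (f w)) => h2; apply: le_trans (ler_normD _ _) _.
by rewrite addrC lerD // ltW.
Qed.

Lemma cube_bounds_gt0 f : cube_continuous f -> (forall a, Q a -> 0 < f a) ->
  exists c C, [/\ 0 < c, 0 < C & forall a, Q a -> c <= f a <= C].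
Proof.
move=> cf f0; have [C C0 fC] := cube_bounded cf.
have [c c0 fc] := cube_bounded (cube_continuousV f0 cf).
exists c^-1, C; split => [||a Qa]; rewrite ?invr_gt0 //.
have fa := f0 _ Qa; have := fC _ Qa; have := fc _ Qa.
rewrite !gtr0_norm ?invr_gt0 // => h ->; rewrite andbT.
by rewrite -[f a]invrK lef_pV2 ?posrE ?invr_gt0.
Qed.

(** [f] is the pointwise limit of its step functions on finer grids, each a finite combination of
    indicators of boxes. *)
Lemma cube_continuous_measurable f : cube_continuous f -> measurable_fun Q f.
Proof.
move=> /cube_continuous_unif /grid_approx uf.
pose g N (a : tup) := f (grid_point (cells N.+1 a)).
apply: (@measurable_fun_cvg _ _ _ _ g) => [N|a Qa]; last first.
  apply/cvgrPdist_lt => eps e0; have [N0 HN] := uf _ e0.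
  exists N0 => // N /= N0N; apply: HN => //; exact: leq_trans N0N (leqnSn _).
pose B (beta : {ffun 'I_n -> 'I_(N.+1.*2.+1)}) : set tup :=
  [set a | forall k, cell_set (beta k) (tnth a k)].
have mB beta : measurable (B beta).
  apply: (@measurable_box R n (fun k => cell_set (beta k))) => k.
  exact: measurable_cell_set.
pose G a := \sum_(beta : {ffun 'I_n -> 'I_(N.+1.*2.+1)})
  f (grid_point beta) * \1_(B beta) a.
have E : {in Q, G =1 g N}.
  move=> a; rewrite inE => Qa; rewrite /G (bigD1 (cells N.+1 a)) //= big1 ?addr0.
    rewrite indicE mem_set ?mulr1 // => k; split; first exact: Qa.
    by rewrite ffunE.
  move=> beta ba; rewrite indicE memNset ?mulr0 // => Bb.
  move/eqP: ba; apply; apply/ffunP => k; rewrite ffunE.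
  by have [_ ->] := Bb k.
apply: eq_measurable_fun E _; apply: measurable_sum => beta.
apply: measurable_funM; first exact: measurable_cst.
by apply: measurable_funS (_ : measurable_fun setT _) => //; exact: measurable_indic.
Qed.

End Grid.

(** * Continuity of absolutely convergent power series on the cube *)

Section AnalyticContinuity.
Context {R : realType} (n : nat).
Local Notation RB := (measurableTypeR R).
Local Notation tup := (n.-tuple RB).
Local Notation Q := (@ncube R n).

Let emb N (alpha : {ffun 'I_n -> 'I_N}) : {ffun 'I_n -> nat} :=
  [ffun k => val (alpha k)].

Let emb_inj N : injective (@emb N).
Proof.
move=> x y /ffunP h; apply/ffunP => k; have := h k.
by rewrite !ffunE => /val_inj.
Qed.

Let summable_bound (g : {ffun 'I_n -> nat} -> R) :
  summable [set: {ffun 'I_n -> nat}] (EFin \o g) ->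
  exists2 B, 0 <= B &
    forall N, \sum_(alpha : {ffun 'I_n -> 'I_N}) `|g (emb alpha)| <= B.
Proof.
rewrite summableE => h.
exists (fine (\esum_(x in [set: {ffun 'I_n -> nat}]) `|(EFin \o g) x|%E)).
  by rewrite fine_ge0 // esum_ge0.
move=> N; rewrite -lee_fin fineK //; apply: esum_ge.
exists [set emb alpha | alpha in [set: {ffun 'I_n -> 'I_N}]].
  by split; [exact: finite_image|].
rewrite fsbig_image; last by move=> x y _ _; exact: emb_inj.
rewrite (fsbigE (enum {ffun 'I_n -> 'I_N})) //=; last 2 first.
- exact: enum_uniq.
- by move=> i _; rewrite mem_enum.
rewrite big_mkcond /= big_enum_cond /= -sumEFin.
by rewrite [leRHS](eq_bigl xpredT) // => x; rewrite mem_set.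
Qed.

(** Near [w] the series is compared with the one at a single point [x0] of the cube, at distance
    [rho] from [w] in every coordinate. If [x] is within [theta * rho] of [w], each nonconstant term
    at [x] is at most [theta] times that at [x0], so [f x - f w] is bounded by [theta] times the
    absolute sum at [x0]. *)
Lemma real_analytic_cube_continuous (f : tup -> R) :
  real_analytic_on Q f -> cube_continuous f.
Proof.
move=> af w Qw eps e0; have [c [r [r0 H]]] := af w Qw.
pose rho := Num.min (r / 2) 1.
have rho0 : 0 < rho by rewrite lt_min divr_gt0 /=.
have rho1 : rho <= 1 by rewrite ge_min lexx orbT.
have rhor : rho < r.
  by rewrite gt_min ltr_pdivrMr // ltr_pMr // ltr1n.
(* A step of length at most 1 against the sign of the coordinate stays in [[-1, 1]]. *)
pose x0 : tup := [tuple (if 0 < (tnth w k : R) then (tnth w k : R) - rho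
                   else (tnth w k : R) + rho) | k < n].
have x0w k : `|(tnth x0 k : R) - tnth w k| = rho.
  rewrite tnth_mktuple; case: ifP => _.
    by rewrite addrAC subrr add0r normrN gtr0_norm.
  by rewrite addrAC subrr add0r gtr0_norm.
have Qx0 : Q x0.
  move=> k; rewrite tnth_mktuple; have := Qw k; rewrite !in_itv /= => /andP[h1 h2].
  by case: ltP => h3; apply/andP; split; lra.
have [B B0 HB] : exists2 B, 0 <= B & forall N,
    \sum_(alpha : {ffun 'I_n -> 'I_N}) `|power_term c w x0 (emb alpha)| <= B.
  apply: summable_bound.
  by have [] := H x0 Qx0 (fun k => eq_ind_r (fun z => z < r) rhor (x0w k)).
have nx0 alpha : `|power_term c w x0 alpha| = `|c alpha| * \prod_(k < n) rho ^+ alpha k.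
  rewrite normrM normr_prod; congr (_ * _); apply: eq_bigr => k _.
  by rewrite normrX x0w.
(* [B + 1] keeps the denominator positive when [B = 0], and the factor 2 makes [theta * B < eps]
   strict. *)
pose theta := Num.min 1 (eps / (2 * (B + 1))).
have B1 : 0 < 2 * (B + 1) by rewrite mulr_gt0 // ltr_wpDl.
have theta0 : 0 < theta by rewrite lt_min ltr01 divr_gt0.
have theta1 : theta <= 1 by rewrite ge_min lexx.
have thetaB : theta * B < eps.
  apply: (@le_lt_trans _ _ (eps / (2 * (B + 1)) * B)).
    by rewrite ler_wpM2r // ge_min lexx orbT.
  rewrite mulrAC ltr_pdivrMr // ltr_pM2l //; lra.
exists (theta * rho); first by rewrite mulr_gt0.
move=> x Qx xw.
have xr k : `|(tnth x k : R) - tnth w k| < r.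
  apply: lt_trans (xw k) _; apply: le_lt_trans rhor.
  by rewrite ler_piMl // ltW.
have wr k : `|(tnth w k : R) - tnth w k| < r by rewrite subrr normr0.
have [_ cx] := H x Qx xr; have [_ cw] := H w Qw wr.
pose S (y : tup) N := \sum_(alpha : {ffun 'I_n -> 'I_N}) power_term c w y (emb alpha).
have term alpha : `|power_term c w x alpha - power_term c w w alpha| <=
    theta * `|power_term c w x0 alpha|.
  have [a0|/forallPn[k ak]] := boolP [forall k, alpha k == 0%N].
    have E y : power_term c w y alpha = c alpha.
      rewrite /power_term big1 ?mulr1 // => k _.
      by rewrite (eqP (forallP a0 k)) expr0.
    by rewrite !E subrr normr0 mulr_ge0 // ltW.
  have -> : power_term c w w alpha = 0.
    rewrite /power_term (bigD1 k) //= subrr.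
    by case: (alpha k) ak => // j _; rewrite exprS !mul0r mulr0.
  rewrite subr0 nx0 /power_term normrM mulrCA ler_wpM2l // normr_prod.
  rewrite (bigD1 k) //= [X in _ <= _ * X](bigD1 k) //= mulrA.
  (* One factor of the coordinate [k], whose exponent is positive, supplies [theta]; all other
     factors are bounded by [rho]. *)
  apply: ler_pM; rewrite ?prodr_ge0 //.
    rewrite normrX; case: (alpha k) ak => // j _; rewrite !exprS mulrA.
    apply: ler_pM; rewrite ?exprn_ge0 //; first exact: ltW.
    apply: lerXn2r; rewrite ?nnegrE ?(ltW rho0) //.
    by apply: le_trans (ltW (xw k)) _; rewrite ler_piMl // ltW.
  apply: ler_prod => l _; rewrite normrX exprn_ge0 //=.
  apply: lerXn2r; rewrite ?nnegrE ?(ltW rho0) //.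
  by apply: le_trans (ltW (xw l)) _; rewrite ler_piMl // ltW.
have SB N : `|S x N - S w N| <= theta * B.
  rewrite /S -sumrB; apply: le_trans (ler_norm_sum _ _ _) _.
  apply: (@le_trans _ _ (\sum_(alpha : {ffun 'I_n -> 'I_N})
      theta * `|power_term c w x0 (emb alpha)|)).
    by apply: ler_sum => alpha _; exact: term.
  by rewrite -mulr_sumr ler_wpM2l // ltW.
apply: le_lt_trans thetaB.
have cS : (fun N => `|S x N - S w N|) @ \oo --> `|f x - f w|.
  by apply: cvg_norm; apply: cvgB.
by apply: ler_cvg_to cS (cvg_cst (theta * B)) _; near=> N; exact: SB.
Unshelve. all: by end_near.
Qed.

End AnalyticContinuity.

(** * Unions of product sublevel sets *)

Section UnionAsymptotics.
Context {R : realType} (n m : nat).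
Hypothesis m0 : (0 < m)%N.
Local Notation RB := (measurableTypeR R).
Local Notation tup := (n.-tuple RB).
Local Notation Q := (@ncube R n).
Local Notation mu := (@lebesgue_tuple R n).
Local Notation full := (fun=> `[-1, 1]%classic : set RB).
Local Notation asym := (@asym R n m).
Implicit Types (P : {set 'I_n}).

Let measurable_full (k : 'I_n) : measurable (full k).
Proof. exact: measurable_itv. Qed.

Let leb_sym (d : R) : 0 < d -> fine (lebesgue_measure `[- d, d]%classic) = 2 * d.
Proof.
move=> d0; rewrite lebesgue_measure_itv /= lte_fin gtrN // -EFinB /=; ring.
Qed.

Definition cube_term P (c lambda : R) : tup -> R := box_term full P c lambda.

Lemma cube_termE P c lambda a : Q a ->
  cube_term P c lambda a = ((tprod P a <= c * lambda)%R : bool)%:R.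
Proof.
move=> Qa; rewrite /cube_term /box_term indicE; congr ((nat_of_bool _)%:R).
apply/idP/idP; first by rewrite inE => -[].
by move=> h; rewrite inE; split => // k; exact: Qa.
Qed.

Lemma asym_cube_term P c : 0 < c -> (#|P| <= m)%N ->
  asym (cube_term P c)
    (2 ^+ #|~: P| * 2 ^+ #|P| * (c * ((#|P| == m)%:R / (m.-1)`!%:R))).
Proof.
move=> c0 Pm; have := @asym_box_term R n m m0 full P c measurable_full
  (fun _ _ h => h) (fun _ _ => erefl) c0 Pm.
suff -> : \prod_(k | k \notin P) fine (lebesgue_measure (full k)) = 2 ^+ #|~: P| :> R.
  by [].
rewrite -prodr_const; apply: eq_big => k; first by rewrite inE.
by move=> _; rewrite leb_sym // mulr1.
Qed.

Lemma asym_cube_term0 P c : 0 < c -> (#|P| < m)%N -> asym (cube_term P c) 0.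
Proof.
move=> c0 Pm; have := asym_cube_term c0 (ltnW Pm).
by rewrite ltn_eqF // mul0r !mulr0.
Qed.

Lemma asym_squeeze0 (f : R -> tup -> R) :
  (forall lambda, 0 < lambda -> mu.-integrable Q (EFin \o f lambda)) ->
  (forall lambda a, 0 <= f lambda a) ->
  (forall eps, 0 < eps -> exists up u, [/\ asym up u, u <= eps &
    \forall lambda \near 0^'+, forall a, Q a -> f lambda a <= up lambda a]) ->
  asym f 0.
Proof.
move=> If f0 sq.
have [l al] : exists l, asym f l.
  apply: asym_squeeze => // eps e0; have [up [u [au ue fu]]] := sq _ e0.
  exists (fun _ _ => 0), up, 0, u; split => //; first exact: asym0.
    by rewrite add0r.
  by near=> x => a Qa; rewrite f0 /=; move: a Qa; near: x.
suff <- : l = 0 by [].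
apply/eqP; rewrite eq_le; apply/andP; split; last first.
  apply: (asym_le (f := fun _ _ => 0) _ al); first exact: asym0.
  by near=> x => a _.
apply/ler_addgt0Pr => eps e0; rewrite add0r; have [up [u [au ue fu]]] := sq _ e0.
by apply: le_trans ue; exact: asym_le al au fu.
Unshelve. all: by end_near.
Qed.

Lemma box_term01 (A : 'I_n -> set RB) P c lambda a :
  0 <= box_term A P c lambda a <= 1.
Proof.
by rewrite /box_term indicE; case: (_ \in _); rewrite /= ?lexx ?ler01.
Qed.

Lemma tprodD1 P k (a : tup) : k \in P ->
  tprod P a = `|tnth a k : R| * tprod (P :\ k)%SET a.
Proof. by move=> kP; rewrite /tprod (big_setD1 k). Qed.

Lemma tprodD1_le P k (a : tup) d t : k \in P -> 0 < d ->
  d <= `|tnth a k : R| -> tprod P a <= t -> tprod (P :\ k)%SET a <= t / d.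
Proof.
move=> kP d0 dk tP; rewrite ler_pdivlMr // mulrC; apply: le_trans tP.
by rewrite (tprodD1 _ kP) ler_wpM2r // tprod_ge0.
Qed.

Lemma cube_term_integrable_mul P P' c c' lambda :
  mu.-integrable Q
    (EFin \o (fun a => cube_term P c lambda a * cube_term P' c' lambda a)).
Proof.
apply: (@ncube_integrable _ _ _ 1).
  by apply: measurable_funM; exact: measurable_box_term.
move=> a _; have /andP[h1 h2] := box_term01 full P c lambda a.
have /andP[h3 h4] := box_term01 full P' c' lambda a.
by rewrite normrM !ger0_norm // mulr_ile1.
Qed.

(* On the coordinate [f] of [P'] outside [P]: small values cost a factor
   [delta] in the volume, large values leave a product of [m - 1] factors. *)
Lemma asym_cube_term_mul P P' c : 0 < c -> #|P| = m -> #|P'| = m -> P != P' ->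
  asym (fun lambda a => cube_term P c lambda a * cube_term P' c lambda a) 0.
Proof.
move=> c0 Pm P'm PP'.
have [f fP' fP] : exists2 f, f \in P' & f \notin P.
  apply/fintype.subsetPn; apply: contra PP' => P'P.
  by rewrite eq_sym eqEcard P'P Pm P'm leqnn.
apply: asym_squeeze0 => [l _|l a|eps e0].
- exact: cube_term_integrable_mul.
- have /andP[h1 _] := box_term01 full P c l a.
  by have /andP[h3 _] := box_term01 full P' c l a; rewrite mulr_ge0.
(* [K * d] is the limit for the slab on which coordinate [f] ranges over [[- d, d]]; the last factor
   2 comes from its width [2 * d]. *)
pose K := \prod_(k | (k \notin P) && (k != f)) 2 * 2 ^+ m * (c / (m.-1)`!%:R) * 2.
have K0 : 0 < K.
  rewrite !mulr_gt0 ?prodr_gt0 ?exprn_gt0 ?invr_gt0 ?ltr0n ?fact_gt0 //.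
pose d := Num.min 1 (eps / K).
have d0 : 0 < d by rewrite lt_min ltr01 divr_gt0.
have d1 : d <= 1 by rewrite ge_min lexx.
pose A k : set RB := if k == f then `[- d, d]%classic else `[-1, 1]%classic.
have mA k : measurable (A k) by rewrite /A; case: ifP => _; exact: measurable_itv.
exists (fun l a => box_term A P c l a + cube_term (P' :\ f)%SET (c / d) l a).
have aA : asym (box_term A P c) (K * d).
  have A1 k : A k `<=` `[-1, 1].
    move=> x; rewrite /A; case: ifP => // _ /=; rewrite !in_itv /= => /andP[h1 h2].
    by apply/andP; split; lra.
  have AP k : k \in P -> A k = `[-1, 1]%classic.
    by move=> kP; rewrite /A; case: eqVneq kP fP => [->->|].
  have E : K * d = \prod_(k | k \notin P) fine (lebesgue_measure (A k)) * 2 ^+ #|P| *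
      (c * ((#|P| == m)%:R / (m.-1)`!%:R)).
    rewrite Pm eqxx (bigD1 f) //= {1}/A eqxx leb_sym //.
    have -> : \prod_(i | (i \notin P) && (i != f)) fine (lebesgue_measure (A i)) =
        \prod_(k | (k \notin P) && (k != f)) 2 :> R.
      by apply: eq_bigr => k /andP[_ /negbTE kf]; rewrite /A kf leb_sym // mulr1.
    by rewrite /K; ring.
  by rewrite E; apply: asym_box_term => //; rewrite Pm.
exists (K * d + 0); split.
- apply: asymD => //; apply: asym_cube_term0; first by rewrite divr_gt0.
  by rewrite -P'm (cardsD1 f P') fP'.
- by rewrite addr0 mulrC -ler_pdivlMr // ge_min lexx orbT.
near=> l => a Qa; rewrite !cube_termE // -natrM mulnb.
have [/andP[h1 h2]|_] := boolP (_ && _); last first.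
  by rewrite addr_ge0 //; have /andP[] := box_term01 A P c l a.
have [af|af] := leP `|tnth a f : R| d.
  rewrite (_ : box_term A P c l a = 1) ?lerDl //.
  rewrite /box_term indicE mem_set //; split => // k; rewrite /A.
  case: eqVneq => [->|_]; last exact: Qa.
  by rewrite /= in_itv /= -ler_norml.
rewrite (_ : tprod _ a <= _) ?lerDr; first by have /andP[] := box_term01 A P c l a.
by rewrite mulrAC; apply: tprodD1_le => //; exact: ltW.
Unshelve. all: by end_near.
Qed.

(** * Finite unions with varying factors and density *)

Section Union.
Context {I : finType} (P : I -> {set 'I_n}) (u : I -> tup -> R) (phi : tup -> R).
Hypothesis P_le : forall i, (#|P i| <= m)%N.
Hypothesis u_cont : forall i, cube_continuous (u i).
Hypothesis u_gt0 : forall i a, Q a -> 0 < u i a.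
Hypothesis phi_cont : cube_continuous phi.
Hypothesis phi_gt0 : forall a, Q a -> 0 < phi a.

Definition sublevel (J : pred I) (lambda : R) : set tup :=
  [set a | exists2 i, J i & tprod (P i) a * u i a <= lambda].

Definition sublevel_weight (J : pred I) (lambda : R) (a : tup) : R :=
  phi a * \1_(sublevel J lambda) a.

Lemma measurable_sublevel J lambda : measurable (Q `&` sublevel J lambda).
Proof.
rewrite (_ : _ `&` _ = \big[setU/set0]_(i | J i)
    (Q `&` [set a | tprod (P i) a * u i a <= lambda])).
  apply: bigsetU_measurable => i _.
  have mf : measurable_fun Q (fun a => tprod (P i) a * u i a).
    apply: measurable_funM; last exact: cube_continuous_measurable.
    apply: measurable_funS (_ : measurable_fun setT _) => //.
    exact: measurable_tprod.
  have -> : [set a | tprod (P i) a * u i a <= lambda] =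
      (fun a => tprod (P i) a * u i a) @^-1` `]-oo, lambda]%classic.
    by apply/seteqP; split => a /=; rewrite in_itv.
  by apply: mf; [exact: measurable_ncube|exact: measurable_itv].
rewrite -bigcup_seq_cond; apply/seteqP; split => a.
  move=> [Qa [i Ji h]]; exists i => //=; by rewrite mem_index_enum.
by move=> [i /= /andP[_ Ji] [Qa h]]; split => //; exists i.
Qed.

Lemma sublevel_weight_integrable J lambda :
  mu.-integrable Q (EFin \o sublevel_weight J lambda).
Proof.
have [M M0 HM] := cube_bounded phi_cont.
apply: (@ncube_integrable _ _ _ M).
  apply: measurable_funM; first exact: cube_continuous_measurable.
  have E : {in Q, \1_(Q `&` sublevel J lambda) =1 (\1_(sublevel J lambda) : tup -> R)}.
    move=> a Qa; rewrite !indicE; congr ((nat_of_bool _)%:R).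
    apply/idP/idP; rewrite !inE.
      by move=> [].
    by move=> h; split => //; rewrite inE in Qa.
  apply: eq_measurable_fun E _.
  apply: measurable_funS (_ : measurable_fun setT _) => //.
  by apply: measurable_indic; exact: measurable_sublevel.
move=> a Qa; rewrite normrM indicE.
case: (_ \in _); rewrite ?normr1 ?normr0 ?mulr0 ?mulr1 //.
- exact: HM.
- exact: ltW.
Qed.

Let sw_ge0 J lambda a : Q a -> 0 <= sublevel_weight J lambda a.
Proof.
by move=> Qa; rewrite mulr_ge0 // ltW // phi_gt0.
Qed.

Let swE J lambda a : sublevel J lambda a -> sublevel_weight J lambda a = phi a.
Proof. by move=> h; rewrite /sublevel_weight indicE mem_set // mulr1. Qed.

Let sw0 J lambda a : ~ sublevel J lambda a -> sublevel_weight J lambda a = 0.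
Proof. by move=> h; rewrite /sublevel_weight indicE memNset // mulr0. Qed.

(** Relative errors are what a product sublevel set absorbs, since multiplying [u] by [rho] only
    rescales the level. The positive lower bound on [f] turns the uniform additive error into a
    relative one. *)
Let grid_ratio (f : tup -> R) : cube_continuous f -> (forall a, Q a -> 0 < f a) ->
  forall rho, 1 < rho -> exists N0, forall N, (N0 <= N)%N -> (0 < N)%N ->
    forall a, Q a -> f (grid_point (cells N a)) / rho <= f a <=
                     rho * f (grid_point (cells N a)).
Proof.
move=> cf f0 rho rho1; have [c [C [c0 _ fb]]] := cube_bounds_gt0 cf f0.
have r0 : 0 < rho by rewrite (lt_trans _ rho1).
have ri : rho^-1 < 1 by rewrite invf_lt1.
have e0 : 0 < c * (1 - rho^-1) by rewrite mulr_gt0 // subr_gt0.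
have [N0 HN] := grid_approx (cube_continuous_unif cf) e0.
exists N0 => N N0N N1 a Qa; have := HN N N0N N1 a Qa.
set w := grid_point _; have /andP[cw _] := fb w (grid_point_cube _ N1).
have /andP[ca _] := fb a Qa.
have hw : c * (1 - rho^-1) <= f w * (1 - rho^-1) by rewrite ler_wpM2r // subr_ge0 ltW.
have ha : c * (1 - rho^-1) <= f a * (1 - rho^-1) by rewrite ler_wpM2r // subr_ge0 ltW.
rewrite ltr_norml => /andP[h1 h2]; apply/andP; split; first by lra.
by rewrite mulrC -ler_pdivrMr //; lra.
Qed.

Let grid_ratios rho : 1 < rho -> exists2 N, (0 < N)%N & forall a, Q a ->
  let w := grid_point (cells N a) in
  (phi w / rho <= phi a <= rho * phi w) /\
  (forall i, u i w / rho <= u i a <= rho * u i w).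
Proof.
move=> rho1; have [N0 HN] := grid_ratio phi_cont phi_gt0 rho1.
have [M HM] := choice (fun i => grid_ratio (u_cont i) (u_gt0 i) rho1).
exists (maxn N0 (\max_i M i)).+1 => // a Qa w; split.
  by apply: HN => //; rewrite leqW // leq_maxl.
move=> i; apply: HM => //; rewrite leqW // leq_max; apply/orP; right.
exact: leq_bigmax.
Qed.

Let u_bounds : exists c C, [/\ 0 < c, 0 < C & forall i a, Q a -> c <= u i a <= C].
Proof.
have [c Hc] := choice (fun i => cube_bounds_gt0 (u_cont i) (u_gt0 i)).
have [C HC] := choice Hc.
(* Sums in place of extrema, with the summand 1 for an empty family. *)
exists ((\sum_i (c i)^-1 + 1)^-1), (\sum_i C i + 1); split.
- rewrite invr_gt0 ltr_wpDl // sumr_ge0 // => i _; rewrite invr_ge0 ltW //.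
  by have [] := HC i.
- rewrite ltr_wpDl // sumr_ge0 // => i _; rewrite ltW //.
  by have [] := HC i.
move=> i a Qa; have [c0 C0 /(_ a Qa)/andP[h1 h2]] := HC i; apply/andP; split.
  apply: le_trans h1; rewrite -[leRHS]invrK lef_pV2 ?posrE ?invr_gt0 //.
    rewrite (bigD1 i) //= -addrA lerDl addr_ge0 // sumr_ge0 // => j _.
    by rewrite invr_ge0 ltW //; have [] := HC j.
  rewrite ltr_wpDl // sumr_ge0 // => j _; rewrite invr_ge0 ltW //.
  by have [] := HC j.
apply: le_trans h2 _; rewrite (bigD1 i) //= -addrA lerDl addr_ge0 // sumr_ge0 // => j _.
by rewrite ltW //; have [] := HC j.
Qed.

(** * All indices that share one edge set of size [m] *)

Section SinglePath.
Variable i0 : I.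
Hypothesis Pi0 : #|P i0| = m.
Let P0 := P i0.
Let J : pred I := fun i => P i == P0.

Section Grid.
Variables (N : nat) (rho c Phi : R).
Hypotheses (N0 : (0 < N)%N) (rho1 : 1 < rho) (c0 : 0 < c).
Hypothesis u_ge : forall i a, Q a -> c <= u i a.
Hypothesis phi_le : forall a, Q a -> phi a <= Phi.
Hypothesis ratio : forall a, Q a ->
  let w := grid_point (cells N a) in
  (phi w / rho <= phi a <= rho * phi w) /\
  (forall i, u i w / rho <= u i a <= rho * u i w).

Let idx := {ffun 'I_n -> 'I_(N.*2.+1)}.
Let central (beta : idx) := [forall k, (k \in P0) ==> (beta k == mid N)].
(** The coordinates in [P0] are released from their cells so that the exact volume formula applies
    to the box. *)
Let A (beta : idx) (k : 'I_n) : set RB :=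
  if k \in P0 then `[-1, 1]%classic else cell_set (beta k).
(* the least of the [u i] with [P i = P0] at the centre of the cell *)
Let umin (beta : idx) : R :=
  u [arg min_(i < i0 | J i) u i (grid_point beta)]%O (grid_point beta).

Let uminP (beta : idx) : exists2 i, J i & umin beta = u i (grid_point beta) /\
  forall j, J j -> umin beta <= u j (grid_point beta).
Proof.
rewrite /umin; case: arg_minP; first by rewrite /J.
by move=> i Ji Hi; exists i.
Qed.

Let umin_gt0 beta : 0 < umin beta.
Proof.
by have [i _ [-> _]] := uminP beta; apply: u_gt0; exact: grid_point_cube.
Qed.

Let rho0 : 0 < rho. Proof. exact: lt_trans rho1. Qed.

Let kap (beta : idx) : R := \prod_(k | k \notin P0) fine (lebesgue_measure (A beta k))
  * 2 ^+ m / (m.-1)`!%:R.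
(** A Riemann sum, up to the factor [2^m / (m-1)!], of the density over the least [u] on the face
    where the coordinates in [P0] vanish: the middle cell is centred at 0. *)
Let X := \sum_(beta | central beta) kap beta * (phi (grid_point beta) / umin beta).

(** If a coordinate in [P0] lies outside its middle cell, it is at least [1 / (2 N)] in absolute
    value, so the other [m - 1] coordinates have product at most [(2 N / c) * lambda], which is
    negligible for fixed [N]. *)
Let err lambda a :=
  Phi * \sum_(k in P0) cube_term (P0 :\ k)%SET ((N.*2)%:R / c) lambda a.
Let up lambda a := \sum_(beta | central beta) (rho * phi (grid_point beta)) *
  box_term (A beta) P0 (rho / umin beta) lambda a + err lambda a.
Let lo lambda a := \sum_(beta | central beta) (phi (grid_point beta) / rho) *
  box_term (A beta) P0 ((rho * umin beta)^-1) lambda a + (-1) * err lambda a.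

Let N2_gt0 : 0 < (N.*2)%:R :> R.
Proof. by rewrite ltr0n double_gt0. Qed.

Let asym_err : asym err 0.
Proof.
rewrite -(mulr0 Phi); apply: asymZ.
rewrite -[X in asym _ X](_ : \sum_(k in P0) (0 : R) = 0); last by rewrite big1.
apply: asym_sum => k kP; apply: asym_cube_term0; first by rewrite divr_gt0.
by rewrite -Pi0 [in X in (_ < X)%N](cardsD1 k) kP.
Qed.

Let mA beta k : measurable (A beta k).
Proof.
by rewrite /A; case: ifP => _; [exact: measurable_itv|exact: measurable_cell_set].
Qed.

Let A1 beta k : A beta k `<=` `[-1, 1].
Proof. by rewrite /A; case: ifP => // _ x []. Qed.

Let asym_box beta s : 0 < s -> asym (box_term (A beta) P0 s) (kap beta * s).
Proof.
move=> s0; have AP k : k \in P0 -> A beta k = `[-1, 1]%classic by rewrite /A => ->.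
have Pm : (#|P0| <= m)%N by rewrite Pi0.
have := asym_box_term m0 (mA beta) (@A1 beta) AP s0 Pm.
rewrite Pi0 eqxx; set v := \prod_(_ | _) _.
suff -> : v * 2 ^+ m * (s * (true%:R / (m.-1)`!%:R)) = kap beta * s by [].
by rewrite /= /kap -/v; ring.
Qed.

Let asym_up : asym up (rho ^+ 2 * X).
Proof.
rewrite -[rho ^+ 2 * X]addr0; apply: asymD => //.
have -> : rho ^+ 2 * X = \sum_(beta | central beta)
    (rho * phi (grid_point beta)) * (kap beta * (rho / umin beta)).
  by rewrite /X mulr_sumr; apply: eq_bigr => beta _; ring.
by apply: asym_sum => beta _; apply: asymZ; apply: asym_box; rewrite divr_gt0.
Qed.

Let asym_lo : asym lo (X / rho ^+ 2).
Proof.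
rewrite -[X / _]addr0 -[X in asym _ (_ + X)](mulr0 (-1)).
apply: asymD; last exact: asymZ.
have -> : X / rho ^+ 2 = \sum_(beta | central beta)
    (phi (grid_point beta) / rho) * (kap beta * (rho * umin beta)^-1).
  rewrite /X mulr_suml; apply: eq_bigr => beta _; field.
  by rewrite !gt_eqF.
apply: asym_sum => beta _; apply: asymZ; apply: asym_box.
by rewrite invr_gt0 mulr_gt0.
Qed.

Let off_center lambda a : Q a -> ~~ central (cells N a) -> tprod P0 a <= lambda / c ->
  Phi <= err lambda a.
Proof.
move=> Qa /forallPn[k]; rewrite negb_imply ffunE => /andP[kP km] aP.
have Phi0 : 0 < Phi by apply: lt_le_trans (phi_le Qa); exact: phi_gt0.
have ak := cell_neq_mid N0 (ncube_norm k Qa) km.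
have Ni : 0 < ((N.*2)%:R : R)^-1 by rewrite invr_gt0.
have hle : tprod (P0 :\ k)%SET a <= (N.*2)%:R / c * lambda.
  by have := tprodD1_le kP Ni ak aP; rewrite invrK mulrC mulrA mulrAC.
rewrite /err -[leLHS]mulr1 ler_pM2l // (bigD1 k) //= cube_termE // hle lerDl.
apply: sumr_ge0 => j _.
by have /andP[] := box_term01 full (P0 :\ j)%SET ((N.*2)%:R / c) lambda a.
Qed.

Let err_ge0 lambda a : Q a -> 0 <= err lambda a.
Proof.
move=> Qa; apply: mulr_ge0.
  by apply: ltW; apply: lt_le_trans (phi_le Qa); exact: phi_gt0.
apply: sumr_ge0 => k _.
by have /andP[] := box_term01 full (P0 :\ k)%SET ((N.*2)%:R / c) lambda a.
Qed.

Let sublevel_tprod lambda a : Q a -> sublevel J lambda a -> tprod P0 a <= lambda / c.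
Proof.
move=> Qa [i /eqP Ji]; rewrite Ji => h; rewrite ler_pdivlMr //.
by apply: le_trans h; rewrite ler_wpM2l ?tprod_ge0 // u_ge.
Qed.

Let le_up lambda a : Q a -> sublevel_weight J lambda a <= up lambda a.
Proof.
move=> Qa; have sum0 : 0 <= \sum_(beta | central beta) (rho * phi (grid_point beta)) *
    box_term (A beta) P0 (rho / umin beta) lambda a.
  apply: sumr_ge0 => beta _; apply: mulr_ge0.
    by rewrite mulr_ge0 ?(ltW rho0) // ltW // phi_gt0 //; exact: grid_point_cube.
  by have /andP[] := box_term01 (A beta) P0 (rho / umin beta) lambda a.
have [sa|nsa] := pselect (sublevel J lambda a); last first.
  by rewrite sw0 // addr_ge0 // err_ge0.
rewrite swE //; have [cen|ncen] := boolP (central (cells N a)); last first.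
  rewrite /up -[leLHS]add0r lerD //; apply: le_trans (phi_le Qa) _.
  by apply: off_center => //; exact: sublevel_tprod.
rewrite /up -[leLHS]addr0 lerD ?err_ge0 // (bigD1 (cells N a)) //=.
have [/andP[_ h1] h2] := ratio Qa.
rewrite (_ : box_term _ _ _ _ _ = 1).
  rewrite mulr1 -[leLHS]addr0; apply: lerD => //.
  apply: sumr_ge0 => beta _; apply: mulr_ge0.
    by rewrite mulr_ge0 ?(ltW rho0) // ltW // phi_gt0 //; exact: grid_point_cube.
  by have /andP[] := box_term01 (A beta) P0 (rho / umin beta) lambda a.
rewrite /box_term indicE mem_set //; split.
  move=> k; rewrite /A; case: ifP => _; first exact: Qa.
  by split; [exact: Qa|rewrite ffunE].
(* Whichever [i] witnesses membership, [u i a >= umin / rho], so the product is at most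
   [rho / umin * lambda]. *)
have [i Ji hi] := sa; have [_ _ [_ Hmin]] := uminP (cells N a).
have /andP[h3 _] := h2 i; have h4 := Hmin i Ji.
rewrite mulrAC ler_pdivlMr // -ler_pdivrMl //.
apply: le_trans hi; rewrite (eqP Ji) mulrCA ler_wpM2l ?tprod_ge0 //.
by apply: le_trans h3; rewrite mulrC ler_wpM2r // invr_ge0 ltW.
Qed.

Let ge_lo lambda a : Q a -> lo lambda a <= sublevel_weight J lambda a.
Proof.
move=> Qa.
(* The only central index whose box can contain [a], so the sum reduces to one term. Where [a]
   itself is not central, that term is at most [Phi] and [err] covers it. *)
pose beta' : idx := [ffun k => if k \in P0 then mid N else cell N (tnth a k : R)].
have cen' : central beta'.
  by apply/forallP => k; apply/implyP => kP; rewrite ffunE kP.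
rewrite /lo (bigD1 beta') //= big1 ?addr0; last first.
  move=> beta /andP[cen bb]; rewrite /box_term indicE memNset ?mulr0 // => -[h _].
  move/eqP: bb; apply; apply/ffunP => k; rewrite ffunE.
  have := h k; rewrite /A; case: ifPn => kP; last by case.
  by move=> _; apply/eqP; have /forallP/(_ k) := cen; rewrite kP.
rewrite mulN1r lerBlDr.
rewrite /box_term indicE; case: (boolP (_ \in _)) => [|_]; last first.
  by rewrite mulr0 addr_ge0 ?err_ge0 // sw_ge0.
rewrite inE => -[_ tl]; rewrite mulr1.
have Qw : Q (grid_point beta') by exact: grid_point_cube.
have r1 : rho^-1 < 1 by rewrite invf_lt1.
have [cen|ncen] := boolP (central (cells N a)); last first.
  rewrite -[leLHS]add0r lerD ?sw_ge0 //; apply: (@le_trans _ _ Phi).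
    apply: le_trans (phi_le Qw); rewrite ler_piMr ?(ltW r1) // ltW //.
    exact: phi_gt0.
  have l0 : 0 <= lambda.
    by have := le_trans (tprod_ge0 P0 a) tl; rewrite pmulr_rge0 // invr_gt0 mulr_gt0.
  apply: off_center => //; apply: le_trans tl _; rewrite mulrC ler_wpM2l //.
  rewrite lef_pV2 ?posrE ?mulr_gt0 //.
  have [i _ [-> _]] := uminP beta'; apply: le_trans (u_ge i Qw) _.
  by rewrite ler_peMl ?(ltW rho1) // ltW // u_gt0.
have E : beta' = cells N a.
  apply/ffunP => k; rewrite !ffunE; case: ifPn => // kP.
  by have /forallP/(_ k) := cen; rewrite kP ffunE => /eqP.
have [/andP[h1 _] h2] := ratio Qa.
rewrite swE ?E; first by rewrite -[leLHS]addr0 lerD // err_ge0.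
have [i Ji [Ei _]] := uminP beta'; exists i => //.
have /andP[_ h3] := h2 i; rewrite -E in h3.
apply: (@le_trans _ _ (tprod P0 a * (rho * umin beta'))).
  by rewrite (eqP Ji) ler_wpM2l ?tprod_ge0 // Ei.
by rewrite -ler_pdivlMr ?mulr_gt0 // mulrC.
Qed.

Lemma grid_sandwich : exists lo up X, [/\ asym lo (X / rho ^+ 2),
  asym up (rho ^+ 2 * X) & forall lambda a, Q a ->
    lo lambda a <= sublevel_weight J lambda a <= up lambda a].
Proof.
exists lo, up, X; split => // lambda a Qa.
by rewrite ge_lo // le_up.
Qed.

End Grid.

(** The grid bounds differ by the factor [rho ^+ 4]. Constant bounds on [u] and [phi] serve twice:
    from above they make this relative gap an absolute one, from below they give positivity. *)
Lemma asym_sublevel_single : exists2 l, 0 < l & asym (sublevel_weight J) l.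
Proof.
have [c [C [c0 C0 ub]]] := u_bounds.
have [b [Phi [b0 Phi0 pb]]] := cube_bounds_gt0 phi_cont phi_gt0.
have Pm : (#|P0| <= m)%N by rewrite Pi0.
pose K := 2 ^+ #|~: P0| * 2 ^+ #|P0| * ((#|P0| == m)%:R / (m.-1)`!%:R) : R.
have K0 : 0 < K by rewrite /K Pi0 eqxx !mulr_gt0 ?exprn_gt0 ?invr_gt0 ?ltr0n ?fact_gt0.
have aK s : 0 < s -> asym (cube_term P0 s) (K * s).
  move=> s0; have := asym_cube_term s0 Pm.
  by rewrite /K [s * _]mulrC !mulrA.
have ci : 0 < c^-1 by rewrite invr_gt0.
have aup := asymZ Phi (aK c^-1 ci).
have sub lambda a : Q a -> sublevel_weight J lambda a <=
    Phi * cube_term P0 c^-1 lambda a.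
  move=> Qa; rewrite cube_termE //.
  have [sa|nsa] := pselect (sublevel J lambda a); last first.
    by rewrite sw0 // mulr_ge0 // ltW.
  rewrite swE // (_ : tprod P0 a <= _) ?mulr1; first by case/andP: (pb _ Qa).
  have [i /eqP Ji] := sa; rewrite Ji => h; rewrite mulrC ler_pdivlMr //.
  by apply: le_trans h; rewrite ler_wpM2l ?tprod_ge0 //; case/andP: (ub i _ Qa).
have [l al] : exists l, asym (sublevel_weight J) l.
  apply: asym_squeeze => // [lambda _|eps e0]; first exact: sublevel_weight_integrable.
  (* The limit of the crude upper bound; it dominates the lower limits of all grids at once. *)
  pose M := Phi * (K * c^-1).
  have M0 : 0 < M by rewrite /M mulr_gt0 // mulr_gt0 // invr_gt0.
  (* 15 is [4 + 6 + 4 + 1]: for [d <= 1] the excess [(1 + d) ^+ 4 - 1] is at most [15 * d]. *)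
  pose d := Num.min 1 (eps / (15 * M)).
  have d0 : 0 < d by rewrite lt_min ltr01 divr_gt0 // mulr_gt0.
  have d1 : d <= 1 by rewrite ge_min lexx.
  have dM : 15 * M * d <= eps.
    have M15 : 0 < 15 * M by rewrite mulr_gt0.
    by rewrite mulrC -ler_pdivlMr // /d ge_min lexx orbT.
  have rho1 : 1 < 1 + d by rewrite ltrDl.
  have [N N0 HN] := grid_ratios rho1.
  have u_ge i a : Q a -> c <= u i a by move=> /(ub i)/andP[].
  have phi_le a : Q a -> phi a <= Phi by move=> /pb/andP[].
  have [lo [up [X [alo aup' lou]]]] := grid_sandwich N0 rho1 c0 u_ge phi_le HN.
  exists lo, up, (X / (1 + d) ^+ 2), ((1 + d) ^+ 2 * X); split => //; last first.
    by near=> x => a; exact: lou.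
  have r0 : 0 < (1 + d) ^+ 2 by rewrite exprn_gt0 // addr_gt0.
  have Y : X / (1 + d) ^+ 2 <= M.
    apply: asym_le alo aup _.
    by near=> x => a Qa; apply: le_trans (sub _ _ Qa); case/andP: (lou x a Qa).
  set Z := X / _ in Y *; have -> : X = Z * (1 + d) ^+ 2 by rewrite /Z divfK // gt_eqF.
  have P4 : 0 <= (1 + d) ^+ 4 - 1 <= 15 * d.
    have -> : (1 + d) ^+ 4 - 1 = d * (4 + 6 * d + 4 * d ^+ 2 + d ^+ 3) by ring.
    have d2 : d ^+ 2 <= 1 by rewrite exprn_ile1 // ltW.
    have d3 : d ^+ 3 <= 1 by rewrite exprn_ile1 // ltW.
    have d2' : 0 <= d ^+ 2 by rewrite exprn_ge0 // ltW.
    have d3' : 0 <= d ^+ 3 by rewrite exprn_ge0 // ltW.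
    apply/andP; split; first by rewrite mulr_ge0 ?(ltW d0) //; lra.
    by rewrite mulrC ler_wpM2r ?(ltW d0) //; lra.
  have {P4}/andP[P40 P41] := P4.
  rewrite -lerBlDl; apply: le_trans dM.
  have -> : (1 + d) ^+ 2 * (Z * (1 + d) ^+ 2) - Z = Z * ((1 + d) ^+ 4 - 1) by ring.
  apply: (@le_trans _ _ (M * ((1 + d) ^+ 4 - 1))); first by rewrite ler_wpM2r.
  have -> : 15 * M * d = M * (15 * d) by ring.
  by rewrite ler_pM2l.
exists l => //.
apply: (@lt_le_trans _ _ (b * (K * C^-1))).
  by rewrite mulr_gt0 // mulr_gt0 // invr_gt0.
have Ci : 0 < C^-1 by rewrite invr_gt0.
apply: asym_le (asymZ b (aK C^-1 Ci)) al _.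
near=> x => a Qa; rewrite cube_termE //.
case: (boolP (tprod P0 a <= C^-1 * x)) => h; last first.
  by rewrite mulr0 sw_ge0.
rewrite mulr1 swE; first by case/andP: (pb _ Qa).
exists i0; rewrite /J //; rewrite mulrC ler_pdivlMr // in h.
by apply: le_trans h; rewrite ler_wpM2l ?tprod_ge0 //; case/andP: (ub i0 _ Qa).
Unshelve. all: by end_near.
Qed.

End SinglePath.

Let codomP (P0 : {set 'I_n}) := (#|P0| == m) && [exists i, P i == P0].

(** Bonferroni's inequalities: the weight of the union is at most the sum over edge sets of size [m]
    plus the smaller sets, and at least that sum minus the pairwise overlaps. Both corrections have
    limit 0. *)
Theorem asym_sublevel : (exists i, #|P i| = m) ->
  exists2 l, 0 < l & asym (sublevel_weight xpredT) l.
Proof.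
move=> [i0 Pi0]; have [c [C [c0 _ ub]]] := u_bounds.
have [b [Phi [_ Phi0 pb]]] := cube_bounds_gt0 phi_cont phi_gt0.
pose W P0 := sublevel_weight (fun i => P i == P0).
have HW (P0 : {set 'I_n}) : exists l, codomP P0 -> 0 < l /\ asym (W P0) l.
  have [/andP[/eqP cP /existsP[i /eqP PiP]]|_] := boolP (codomP P0); last by exists 0.
  rewrite -PiP in cP *; have [l l0 al] := asym_sublevel_single cP.
  by exists l.
have [L HL] := choice HW.
have ci : 0 < c^-1 by rewrite invr_gt0.
have sub P0 lambda a : Q a -> sublevel (fun i => P i == P0) lambda a ->
    tprod P0 a <= c^-1 * lambda.
  move=> Qa [i /eqP Ji]; rewrite Ji => h; rewrite mulrC ler_pdivlMr //.
  by apply: le_trans h; rewrite ler_wpM2l ?tprod_ge0 //; case/andP: (ub i _ Qa).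
pose E1 lambda a :=
  Phi * \sum_(P0 : {set 'I_n} | (#|P0| < m)%N) cube_term P0 c^-1 lambda a.
pose pairs := [pred PP : {set 'I_n} * {set 'I_n} |
  [&& #|PP.1| == m, #|PP.2| == m & PP.1 != PP.2]].
pose E2 lambda a := Phi * \sum_(PP | pairs PP)
  (cube_term PP.1 c^-1 lambda a * cube_term PP.2 c^-1 lambda a).
have aE1 : asym E1 0.
  rewrite -(mulr0 Phi); apply: asymZ.
  rewrite -[X in asym _ X](_ : \sum_(P0 : {set 'I_n} | (#|P0| < m)%N) (0 : R) = 0).
    by apply: asym_sum => P0 Pm; exact: asym_cube_term0.
  by rewrite big1.
have aE2 : asym E2 0.
  rewrite -(mulr0 Phi); apply: asymZ.
  rewrite -[X in asym _ X](_ : \sum_(PP | pairs PP) (0 : R) = 0); last by rewrite big1.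
  apply: asym_sum => -[P1 P2] /and3P[/eqP h1 /eqP h2 h3].
  exact: asym_cube_term_mul.
have aW : asym (fun lambda a => \sum_(P0 | codomP P0) W P0 lambda a)
    (\sum_(P0 | codomP P0) L P0).
  by apply: asym_sum => P0 /HL[].
set S := \sum_(P0 | codomP P0) L P0 in aW.
have S0 : 0 < S.
  have cP0 : codomP (P i0).
    by rewrite /codomP Pi0 eqxx; apply/existsP; exists i0.
  rewrite /S (bigD1 (P i0)) //= ltr_pwDl //; first by have [] := HL _ cP0.
  by apply: sumr_ge0 => P0 /andP[/HL[/ltW]].
have ct0 P0 lambda a : 0 <= cube_term P0 c^-1 lambda a.
  by have /andP[] := box_term01 full P0 c^-1 lambda a.
have aup := asymD aW aE1.
have alo := asymD aW (asymZ (-1) aE2).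
rewrite mulr0 addr0 in alo; rewrite addr0 in aup.
have W0 P0 lambda a : Q a -> 0 <= W P0 lambda a by exact: sw_ge0.
have le_up lambda a : Q a -> sublevel_weight xpredT lambda a <=
    \sum_(P0 | codomP P0) W P0 lambda a + E1 lambda a.
  move=> Qa; have E10 : 0 <= E1 lambda a.
    by apply: mulr_ge0; [exact: ltW|apply: sumr_ge0].
  have sW0 : 0 <= \sum_(P0 | codomP P0) W P0 lambda a.
    by apply: sumr_ge0 => P0 _; exact: W0.
  have [sa|nsa] := pselect (sublevel xpredT lambda a); last by rewrite sw0 // addr_ge0.
  rewrite swE //; have [i _ hi] := sa.
  have si : sublevel (fun j => P j == P i) lambda a by exists i.
  have [Pm|Pm] := eqVneq #|P i| m.
    rewrite -[leLHS]addr0 lerD // (bigD1 (P i)) /=; last first.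
      by rewrite /codomP Pm eqxx; apply/existsP; exists i.
    rewrite {1}/W swE // lerDl; apply: sumr_ge0 => P0 _; exact: W0.
  have {}Pm : (#|P i| < m)%N by rewrite ltn_neqAle Pm P_le.
  rewrite -[leLHS]add0r lerD //.
  apply: (@le_trans _ _ Phi); first by case/andP: (pb _ Qa).
  rewrite /E1 -[leLHS]mulr1 ler_pM2l // (bigD1 (P i)) //= cube_termE // sub //.
  by rewrite lerDl; apply: sumr_ge0.
have ge_lo lambda a : Q a ->
    \sum_(P0 | codomP P0) W P0 lambda a + -1 * E2 lambda a <=
    sublevel_weight xpredT lambda a.
  move=> Qa; rewrite mulN1r lerBlDr.
  have E20 : 0 <= E2 lambda a.
    apply: mulr_ge0; first exact: ltW.
    by apply: sumr_ge0 => PP _; exact: mulr_ge0.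
  have [[P1 [cP1 s1]]|no] := pselect (exists P1, codomP P1 /\
      sublevel (fun i => P i == P1) lambda a); last first.
    rewrite big1 ?addr_ge0 ?sw_ge0 // => P0 cP0; rewrite /W sw0 // => s0.
    by apply: no; exists P0.
  rewrite swE; last by case: s1 => i _ h; exists i.
  rewrite (bigD1 P1) //= {1}/W swE // lerD2l.
  (* With [P1] paying for [phi a] itself, every further group [P0] containing [a] is charged to the
     ordered pair [(P1, P0)]. *)
  rewrite /E2 mulr_sumr (bigID (fun PP => PP.1 == P1)) /=.
  rewrite -[leLHS]addr0 lerD //; last first.
    by apply: sumr_ge0 => PP _; rewrite mulr_ge0 ?(ltW Phi0) // mulr_ge0.
  apply: (@le_trans _ _ (\sum_(P0 | codomP P0 && (P0 != P1))
      Phi * (cube_term P1 c^-1 lambda a * cube_term P0 c^-1 lambda a))).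
    apply: ler_sum => P0 /andP[cP0 P01].
    have [s0|ns0] := pselect (sublevel (fun i => P i == P0) lambda a); last first.
      by rewrite /W sw0 // mulr_ge0 ?(ltW Phi0) // mulr_ge0.
    rewrite /W swE // !cube_termE // !sub // !mulr1.
    by case/andP: (pb _ Qa).
  rewrite [leRHS](_ : _ = \sum_(P0 : {set 'I_n} | (#|P0| == m) && (P0 != P1))
      Phi * (cube_term P1 c^-1 lambda a * cube_term P0 c^-1 lambda a)).
    rewrite big_mkcond [leRHS]big_mkcond /=; apply: ler_sum => P0 _.
    case: ifP => [/andP[/andP[-> _] ->] //|_]; case: ifP => // _.
    by rewrite mulr_ge0 ?(ltW Phi0) // mulr_ge0.
  have /andP[/eqP P1m _] := cP1.
  rewrite (reindex_onto (fun P0 => (P1, P0)) snd) /=; last first.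
    by move=> [P2 P3] /= /andP[_ /eqP ->].
  apply: eq_bigl => P0; rewrite P1m !eqxx !andbT /=.
  by rewrite [P0 == P1]eq_sym.
have [l al] : exists l, asym (sublevel_weight xpredT) l.
  apply: asym_squeeze => // [lambda _|eps e0]; first exact: sublevel_weight_integrable.
  exists (fun lambda a => \sum_(P0 | codomP P0) W P0 lambda a + -1 * E2 lambda a),
    (fun lambda a => \sum_(P0 | codomP P0) W P0 lambda a + E1 lambda a), S, S.
  split => //; first by rewrite lerDl ltW.
  by near=> x => a Qa; rewrite ge_lo // le_up.
exists l => //; apply: lt_le_trans S0 _; apply: asym_le alo al _.
by near=> x => a; exact: ge_lo.
Unshelve. all: by end_near.
Qed.

End Union.
End UnionAsymptotics.

(** * Strong unfaithfulness as a union of product sublevel sets *)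

Section TreeUnion.
Context {R : realType} {p : nat} (e : rel 'I_p).
Hypotheses (eo : topologically_ordered e) (et : tree_dag e).
Local Notation n := #|{: edge e}|.

(** Sequences do not form a finite type; recording a path only through its edge set makes the index
    type of the union finite. *)
Let connection (x : 'I_p * 'I_p * {set 'I_p} * {set 'I_n}) : bool :=
  `[< x.1.1.1 != x.1.1.2 /\ exists2 s, d_connecting e x.1.1.1 x.1.1.2 x.1.2 s &
      x.2 = path_edges e x.1.1.1 s >].

Let P (x : {x | connection x}) : {set 'I_n} := (val x).2.

Lemma strong_unfaithful_sublevel m : longest_path_length e m -> (0 < m)%N ->
  exists (I : finType) (P : I -> {set 'I_n}) (u : I -> params R e -> R),
  [/\ forall i, (#|P i| <= m)%N, exists i, #|P i| = m,
      forall i, cube_continuous (u i), forall i a, cube R e a -> 0 < u i a &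
      forall lambda, @strong_unfaithful R p e lambda =
        cube R e `&` sublevel P u xpredT lambda].
Proof.
move=> [[i0 [s0 [ps0 ss0]]] sm] m0.
have Hu (x : {x | connection x}) : exists u : params R e -> R,
    [/\ cube_continuous u, forall a, 0 < u a & forall a,
      `|corr a (val x).1.1.1 (val x).1.1.2 (val x).1.2| = tprod (P x) a * u a].
  have /asboolP[ij [s ds Ps]] := valP x.
  have [u [cu u0 uE]] := @corr_path R p e eo et _ _ _ _ ij ds.
  exists u; split => //; first exact: tuple_continuousW.
  by move=> a; rewrite uE /P Ps.
have [u Hu'] := choice Hu.
exists {x | connection x}, P, u; split.
- move=> x; have /asboolP[ij [s [ps _ _] Ps]] := valP x.
  by rewrite /P Ps card_path_edges //; exact: sm ps.
- have i0s : i0 != last i0 s0.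
    case: s0 ps0 ss0 => [|v s] ps0 ss0; first by rewrite -ss0 in m0.
    move: ps0 => /andP[_ /= /andP[i0v _]].
    by apply: contraNneq i0v => ->; exact: mem_last.
  (* Having no collider, a longest path d-connects its ends given the empty set, so the size [m] is
     attained. *)
  have c0 : connection (i0, last i0 s0, finset.set0, path_edges e i0 s0).
    apply/asboolP; split => //=; exists s0 => //; split => // k _ /=.
    by rewrite (negbTE (no_collider k eo et ps0)) inE.
  exists (exist (fun y => is_true (connection y)) _ c0).
  by rewrite /P /= card_path_edges.
- by move=> x; have [] := Hu' x.
- by move=> x a _; have [_ + _] := Hu' x; exact.
move=> lambda; apply/seteqP; split => a.
  move=> [ca [i [j [S [ij iS jS /contrapT[s ds] cl]]]]]; split => //.
  have c0 : connection (i, j, S, path_edges e i s).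
    by apply/asboolP; split => //; exists s.
  pose x := exist (fun y => is_true (connection y)) _ c0.
  exists x => //; have [_ _ <-] := Hu' x.
  exact: cl.
move=> [ca [x _ hx]]; split => //; have /asboolP[ij [s ds Ps]] := valP x.
exists (val x).1.1.1, (val x).1.1.2, (val x).1.2; split => //.
(* End points are never colliders, so d-connection by itself forces them outside [S]. *)
- by have [_ _ /(_ 0%N isT)] := ds; rewrite /is_collider.
- have [_ sj /(_ (size s) (leqnn _))] := ds.
  by rewrite /is_collider ltnn /= andbF nth_last /= sj.
- by move=> ns; apply: ns; exists s.
- by have [_ _ ->] := Hu' x.
Qed.

End TreeUnion.

(** * Asymptotics of the unfaithful volume *)

Unset Implicit Arguments.

Theorem theorem5p1 (R : realType) (p : nat) (e : rel 'I_p)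
    (e_ordered : topologically_ordered e) (e_tree : tree_dag e)
    (e_nonempty : exists i j, e i j)
    (phi : params R e -> R)
    (phi_gt0 : forall a, cube R e a -> 0 < phi a)
    (phi_analytic : real_analytic_on (cube R e) phi)
    (phi_prob : (\int[@lebesgue_tuple R _]_(a in cube R e) (phi a)%:E = 1)%E)
    (m : nat) (m_longest : longest_path_length e m) :
  exists C : R, 0 < C /\
    (unfaithful_volume phi : R -> R^o)
      ~_(0^'+) (fun lambda => C * (lambda * (- ln lambda) ^+ m.-1)).
Proof.
(* An edge is a path of length 1, so [m.-1] is a true predecessor. *)
have m0 : (0 < m)%N.
  have [i [j eij]] := e_nonempty; apply: (m_longest.2 i [:: j]).
  rewrite /undirected_path /= /skeleton /= eij /= inE andbT.
  by apply: contraTneq eij => ->; apply/negP => /e_ordered; rewrite ltnn.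
have [I [P [u [Pm Pex cu u0 TE]]]] :=
  @strong_unfaithful_sublevel R p e e_ordered e_tree m m_longest m0.
have cphi := real_analytic_cube_continuous phi_analytic.
have [C C0 [_ aC]] := asym_sublevel m0 Pm cu u0 cphi phi_gt0 Pex.
exists C; split => //; apply/eqaddoP => eps eps0.
(* The remainder is measured against [C * log_scale m l], so the quotient must be within [eps * C]
   of its limit. *)
have eC : 0 < eps * C by rewrite mulr_gt0.
near=> l.
have l0 : 0 < l by near: l; exact: nbhs_right_gt.
have l1 : l < 1 by near: l; exact: nbhs_right_lt.
have h0 : 0 < log_scale m l by exact: log_scale_gt0.
have VE : unfaithful_volume phi l =
    (\int[@lebesgue_tuple R _]_(a in cube R e) sublevel_weight P u phi xpredT l a)%R.
  rewrite /unfaithful_volume TE Rintegral_mkcondr; apply: eq_Rintegral => a _.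
  rewrite /sublevel_weight patchE indicE.
  by case: (_ \in _); rewrite ?mulr1 ?mulr0.
have : `|C - unfaithful_volume phi l / log_scale m l| < eps * C.
  by rewrite VE; near: l; exact: cvgr_dist_lt.
rewrite -[l * _]/(log_scale m l) => H.
change (`|unfaithful_volume phi l - C * log_scale m l| <= eps * `|C * log_scale m l|).
move: H h0; set h := log_scale m l; set V := unfaithful_volume phi l => H h0.
have -> : V - C * h = (V / h - C) * h by rewrite mulrBl divfK // gt_eqF.
have key : `|V / h - C| * h <= eps * C * h by rewrite ler_pM2r // distrC ltW.
rewrite normrM (gtr0_norm h0) (gtr0_norm (mulr_gt0 C0 h0)) [eps * _]mulrA.
exact: key.
Unshelve. all: by end_near.
Qed.
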